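(* Let $\nu,a,b\in\mathbb{R}$ with $0<b+\nu<(a+\nu)/4$ (so $b<a$). Then: (1) the equation $\lambda_2(a,u,b)=\lambda_3(a,u,b)$ has a unique solution $u=u^*$ in the interval $b<u<a$; put $\alpha=\lambda_2(a,u^*,b)$. (2) There are functions $u_2,u_3$ of $(x,t)$, defined for $t>0$ and $(3a-\nu)/4<x/t<2a+b+2\nu$, with $b\le u_3<u_2<a$, such that, with $u_1\equiv a$: - for $(3a-\nu)/4<x/t\le\alpha$: $x=\lambda_2(a,u_2,u_3)\,t$ and $x=\lambda_3(a,u_2,u_3)\,t$; - for $\alpha\le x/t<2a+b+2\nu$: $x=\lambda_2(a,u_2,b)\,t$ and $u_3=b$; and $(u_1,u_2,u_3)$ solves the Whitham equations $\partial_t u_i+\lambda_i(u_1,u_2,u_3)\,\partial_x u_i=0$, $i=1,2,3$, in this region. (3) Outside this region the solution of the Burgers equation $u_t+(3u+2\nu)u_x=0$ with step initial data $u(x,0)=a$ for $x<0$, $u(x,0)=b$ for $x>0$ is $u\equiv a$ for $x/t\le(3a-\nu)/4$ and $u\equiv b$ for $x/t\ge 2a+b+2\nu$; the boundaries $x/t=(3a-\nu)/4$ (trailing edge, where $u_1=u$ and $u_2=u_3$) and $x/t=2a+b+2\nu$ (leading edge, where $u_1=u_2$ and $u_3=u$) separate the Whitham region from the Burgers region.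
   Context: For $-\nu<u_3<u_2<u_1$ define $$I(u_1,u_2,u_3)=\int_{u_3}^{u_2}\frac{\eta+\nu}{\sqrt{(\eta+\nu)(u_1-\eta)(u_2-\eta)(\eta-u_3)}}\,d\eta,$$ and for $i=1,2,3$ $$\lambda_i=u_1+u_2+u_3+2\nu-\frac{I}{\partial I/\partial u_i}.$$ These functions extend continuously to the boundary of their domain. - On $u_2=u_3<u_1$: $\lambda_1=3u_1+2\nu$ and $\lambda_2=\lambda_3=u_1+2u_3+2\nu-4(u_3+\nu)(u_1-u_3)/(u_1+\nu)$. - On $u_1=u_2>u_3$: $\lambda_1=\lambda_2=2u_1+u_3+2\nu$ and $\lambda_3=3u_3+2\nu$. The Whitham equations are the system $\partial_t u_i+\lambda_i\partial_x u_i=0$ for $-\nu<u_3<u_2<u_1$. They arise as modulation equations of the Camassa–Holm equation with step initial data.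
   Formalization: The Whitham equations are asserted, in the classical sense, in the region with the line x/t = α removed; on that line u_3 has a kink (left slope in x/t nonzero, right slope zero), so ∂_x u_3 and ∂_t u_3 do not exist there and the system cannot hold classically. *)

(* Defs.v *)
From HB Require Import structures.
From mathcomp Require Import all_boot all_order all_algebra.
From mathcomp Require Import all_classical all_reals all_analysis.
Set Implicit Arguments. Unset Strict Implicit. Unset Printing Implicit Defensive.
Import Order.TTheory GRing.Theory Num.Theory.
Import numFieldNormedType.Exports.
Local Open Scope classical_set_scope.
Local Open Scope ring_scope.

Section Whitham.
Variable R : realType.

(* I(u1,u2,u3) = \int_{u3}^{u2} (eta+nu)/sqrt((eta+nu)(u1-eta)(u2-eta)(eta-u3)) d eta
   (improper at both endpoints; taken as a Lebesgue integral over ]u3,u2[). *)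
Definition Iint (nu u1 u2 u3 : R) : R :=
  \int[@lebesgue_measure R]_(eta in `]u3, u2[)
     ((eta + nu) / Num.sqrt ((eta + nu) * (u1 - eta) * (u2 - eta) * (eta - u3))).

Definition dI1 (nu u1 u2 u3 : R) : R := derive1 (fun s => Iint nu s u2 u3) u1.
Definition dI2 (nu u1 u2 u3 : R) : R := derive1 (fun s => Iint nu u1 s u3) u2.
Definition dI3 (nu u1 u2 u3 : R) : R := derive1 (fun s => Iint nu u1 u2 s) u3.

(* Whitham speeds lambda_i = u1+u2+u3+2nu - I / (dI/du_i), on -nu<u3<u2<u1 *)
Definition lam1 (nu u1 u2 u3 : R) : R :=
  u1 + u2 + u3 + 2 * nu - Iint nu u1 u2 u3 / dI1 nu u1 u2 u3.
Definition lam2 (nu u1 u2 u3 : R) : R :=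
  u1 + u2 + u3 + 2 * nu - Iint nu u1 u2 u3 / dI2 nu u1 u2 u3.
Definition lam3 (nu u1 u2 u3 : R) : R :=
  u1 + u2 + u3 + 2 * nu - Iint nu u1 u2 u3 / dI3 nu u1 u2 u3.

Definition transport_at (u c : R -> R -> R) (x t : R) : Prop :=
  derivable (fun s => u s t) x 1 /\ derivable (fun s => u x s) t 1 /\
  derive1 (fun s => u x s) t + c x t * derive1 (fun s => u s t) x = 0.

(* step-data Burgers solution outside the Whitham zone:
   a for x/t <= (3a-nu)/4, b for x/t >= 2a+b+2nu (initial data a for x<0, b for x>0) *)
Definition burgers_outer (nu a b x t : R) : R :=
  if t == 0 then (if x < 0 then a else b)
  else if x / t <= (3 * a - nu) / 4 then a else b.

End Whitham.

(* Main.v *)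
(** With p = u2 and q = u3, the substitution eta = p sin^2 x + q cos^2 x turns I(a, p, q)
    into twice J(p, q) = int_0^(pi/2) phi(p sin^2 x + q cos^2 x) dx, where
    phi(y) = sqrt ((y + nu) / (a - y)); the partial derivatives of J are trigonometric
    means of derivatives of phi. By the Euler-Poisson-Darboux identity
    Jp - Jq = 2 (p - q) Jpq, the speeds lambda_2 and lambda_3 agree exactly where Jpq = 0.
    As phi'' is increasing and changes sign at the inflection point c = (a - 3 nu) / 4, Jpq
    increases in p, is negative for p <= c and positive for p near a; for q < c its zero
    p = root(q) is therefore unique, and it is differentiable in q.
    Along the curve p = root(q) the speed lambda_2 is stationary in q, hence the common
    speed lambda_2(root(q), q) is strictly decreasing, with limit (3a - nu)/4 at q = c;
    beyond the curve lambda_2 is strictly increasing in p, with limit 2a + q + 2 nu at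
    p = a. Inverting the common speed, and then lambda_2(., b), gives functions of x/t; any
    function of x/t is transported with speed x/t. *)
Require Import Defs.
From HB Require Import structures.
From mathcomp Require Import all_boot all_order all_algebra.
From mathcomp Require Import all_classical all_reals all_analysis.
From mathcomp Require Import measurable_realfun ring lra.
Import Order.TTheory GRing.Theory Num.Theory.
Import numFieldNormedType.Exports.
Local Open Scope classical_set_scope.
Local Open Scope ring_scope.
Set Implicit Arguments.
Unset Strict Implicit.
Unset Printing Implicit Defensive.

Lemma is_derive_continuous (K : numFieldType) (V : normedModType K) (f : K -> V)
    (x : K) (l : V) :
  is_derive x 1 f l -> {for x, continuous f}.
Proof. by move=> [df _]; exact/differentiable_continuous/derivable1_diffP. Qed.

Lemma is_diff_nearP (K : numFieldType) (V W : normedModType K) (f : V -> W)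
    (df : {linear V -> W}) (x : V) : continuous df ->
  is_diff x f df <->
  forall e : K, 0 < e -> \forall y \near x, `|f y - f x - df (y - x)| <= e * `|y - x|.
Proof.
move=> cdf.
have nearE (e : K) : (\forall y \near x, `|f y - f x - df (y - x)| <= e * `|y - x|) =
    \forall h \near (0 : V), `|(f \o shift x - (cst (f x) + df)) h| <= e * `|h|.
  rewrite (near_shift 0 x) subr0; congr nbhs; apply/funext => h /=.
  by rewrite addrK !fctE opprD addrA.
have eqoE : f \o shift x = cst (f x) + df +o_ 0 id <->
    forall e : K, 0 < e -> \forall y \near x, `|f y - f x - df (y - x)| <= e * `|y - x|.
  split=> [/eqaddoP oF e /oF|oF]; first by rewrite nearE.
  by apply/eqaddoP => e /oF; rewrite nearE.
split=> [[/diff_locally fE dfE]|/eqoE fE]; first by apply/eqoE; rewrite -dfE.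
have dfE := diff_unique cdf fE.
by apply: DiffDef => //; apply/diff_locallyP; rewrite dfE.
Qed.

Lemma near_strict_derivative (R : realType) (f df : R -> R) (x e : R) :
  (\forall y \near x, is_derive (y : R) 1 f (df y)) -> {for x, continuous df} -> 0 < e ->
  \forall z \near (x, x), `|f z.1 - f z.2 - df z.2 * (z.1 - z.2)| <= e * `|z.1 - z.2|.
Proof.
move=> f_df cdf e0; have e2 : 0 < e / 2 by lra.
have /cvgrPdist_le/(_ _ e2) near_dfx := cdf.
have [d /= d0 near_df] := filterI f_df near_dfx.
exists (ball x d, ball x d) => [|[u v] /= [xu xv]]; first by split; exact: nbhsx_ballx.
have ball_itv (s t y : R) : ball x d s -> ball x d t -> y \in `[s, t] -> ball x d y.
  by rewrite in_itv/= /ball/= !ltr_norml; lra.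
have mvt (s t : R) : ball x d s -> ball x d t -> s <= t ->
    exists2 y, ball x d y & f t - f s = df y * (t - s).
  move=> xs xt st; have st_df y (yst : y \in `[s, t]) := (near_df y (ball_itv s t y xs xt yst)).1.
  have cf : {within `[s, t], continuous f}.
    by apply: derivable_within_continuous => y /st_df[].
  have [y yst ->] := MVT_segment st (fun y yst => st_df y (subset_itv_oo_cc yst)) cf.
  by exists y => //; exact: ball_itv yst.
have [y xy ->] : exists2 y, ball x d y & f u - f v = df y * (u - v).
  have [uv|/ltW vu] := leP u v; last exact: mvt.
  by have [y xy fvu] := mvt _ _ xu xv uv; exists y; rewrite // -opprB fvu -mulrN opprB.
rewrite -mulrBl normrM ler_wpM2r// (splitr e).
rewrite -(subrKA (df x)); apply: (le_trans (ler_normD _ _)); apply: lerD.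
  by rewrite distrC; have [] := near_df y xy.
by have [] := near_df v xv.
Qed.

Lemma near_uniform_linear_approx (R : realType) (f df : R -> R) (A : set R) (lo hi e : R) :
  {in `]lo, hi[, forall y : R, is_derive y 1 f (df y)} -> {in `]lo, hi[, continuous df} ->
  compact A -> A `<=` `]lo, hi[ -> 0 < e ->
  \forall h \near (0 : R), A `<=` [set y | `|f (h + y) - f y - df y * h| <= e * `|h| ].
Proof.
move=> f_df cdf /compact_near_coveringP coverA Alh e0.
apply: (coverA R (nbhs 0) (fun h y => `|f (h + y) - f y - df y * h| <= e * `|h|)).
move=> x /Alh xlh.
have near_df : \forall y \near x, is_derive (y : R) 1 f (df y).
  by near=> y; apply: f_df; near: y; exact: near_in_itvoo.
have shift_cvg : (w.2 + w.1, w.1) @[w --> (nbhs x, nbhs (0 : R))] --> (x, x).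
  rewrite -[X in _ --> (X, _)]add0r.
  exact: cvg_pair (cvgD cvg_snd cvg_fst) cvg_fst.
have [U nbhsU UP] := shift_cvg _ (near_strict_derivative near_df (cdf _ xlh) e0).
by exists U => // -[y h] /UP /=; rewrite addrK.
Unshelve. all: by end_near. Qed.

Section Gradient.
Context {R : realType}.
Implicit Types (F : R -> R -> R) (a b p q : R).

Definition is_gradient F p q a b : Prop :=
  is_diff ((p, q) : R * R) (fun z => F z.1 z.2) (fun h => a * h.1 + b * h.2).

Lemma is_gradientP F p q a b : is_gradient F p q a b <->
  forall e : R, 0 < e -> \forall z \near (p, q),
    `|F z.1 z.2 - F p q - (a * (z.1 - p) + b * (z.2 - q))| <= e * `|z - (p, q)|.
Proof.
pose D (h : R * R) := a * h.1 + b * h.2.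
have linD : linear D by move=> k h h'; rewrite /D /= /GRing.scale/=; ring.
pose linear_D := GRing.isLinear.Build _ _ _ _ _ linD.
apply: (@is_diff_nearP R (R * R)%type R (fun z => F z.1 z.2) (HB.pack D linear_D) (p, q)).
by move=> z; apply: cvgD; apply: cvgM;
  [exact: cvg_cst|exact: cvg_fst|exact: cvg_cst|exact: cvg_snd].
Qed.

Lemma is_gradient_cvg F p q a b (T : Type) (E : set_system T) {FE : Filter E}
    (u v : T -> R) : is_gradient F p q a b ->
  u x @[x --> E] --> p -> v x @[x --> E] --> q -> F (u x) (v x) @[x --> E] --> F p q.
Proof.
move=> [dF _] up vq; have cF := differentiable_continuous dF.
exact: (cvg_comp _ _ (cvg_pair up vq) cF).
Qed.

Lemma is_gradient_is_derive F a b (u v : R -> R) (x du dv : R) :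
  is_gradient F (u x) (v x) a b -> is_derive x 1 u du -> is_derive x 1 v dv ->
  is_derive x 1 (fun s => F (u s) (v s)) (a * du + b * dv).
Proof.
move=> dF du' dv'.
have /derivable1_diffP du_ : derivable u x 1 by [].
have /derivable1_diffP dv_ : derivable v x 1 by [].
have := @is_diff_comp _ _ _ _ (fun s => (u s, v s)) _ (fun z => F z.1 z.2) _ x
  (is_diff_pair (differentiableP du_) (differentiableP dv_)) dF.
move=> [dFuv eFuv]; apply: DeriveDef; first exact/diff_derivable.
by rewrite deriveE// eFuv /= -!deriveE// !derive_val.
Qed.

Lemma is_gradient_caratheodory F p q a b : is_gradient F p q a b ->
  exists A B : R * R -> R,
    [/\ forall z, F z.1 z.2 - F p q = A z * (z.1 - p) + B z * (z.2 - q),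
        {for (p, q), continuous A}, A (p, q) = a,
        {for (p, q), continuous B} & B (p, q) = b].
Proof.
move=> /is_gradientP dF.
pose r (z : R * R) := F z.1 z.2 - F p q - (a * (z.1 - p) + b * (z.2 - q)).
pose N (z : R * R) := (z.1 - p) ^+ 2 + (z.2 - q) ^+ 2.
have r_small (d : R * R -> R) : (forall z, `|d z| <= `|z - (p, q)|) ->
    r z * d z / N z @[z --> (p, q)] --> 0.
  move=> dle; apply/cvgrPdist_le => e e0; have := dF e e0; apply: filterS => z rz.
  rewrite sub0r normrN !normrM normfV.
  have N0 : 0 <= N z by rewrite addr_ge0 ?sqr_ge0.
  rewrite (ger0_norm N0); have [->|Nz] := eqVneq (N z) 0.
    by rewrite invr0 mulr0 ltW.
  rewrite ler_pdivrMr ?lt_def ?Nz//; apply: (le_trans (ler_pM _ _ rz (dle z))) => //.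
  rewrite -mulrA ler_pM2l// -expr2 /N prod_normE/=.
  by rewrite /Num.max; case: ifP => _; rewrite real_normK ?num_real// ?lerDl ?lerDr sqr_ge0.
have r_cont (c : R) (d : R * R -> R) : (forall z, `|d z| <= `|z - (p, q)|) ->
    d (p, q) = 0 -> {for (p, q), continuous (fun z => c + r z * d z / N z)}.
  move=> dle d0; rewrite /prop_for /continuous_at /= d0 mulr0 mul0r.
  by apply: cvgD; [exact: cvg_cst|exact: r_small].
exists (fun z => a + r z * (z.1 - p) / N z), (fun z => b + r z * (z.2 - q) / N z).
split; rewrite ?subrr ?mulr0 ?mul0r ?addr0//=.
- move=> z; have [N0|Nz] := eqVneq (N z) 0; last by move: Nz; rewrite /r /N => Nz; field.
  have := paddr_eq0 (sqr_ge0 (z.1 - p)) (sqr_ge0 (z.2 - q)).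
  rewrite -/(N z) N0 eqxx !sqrf_eq0 !subr_eq0 => /esym/andP[/eqP-> /eqP->].
  by rewrite !subrr !mulr0 addr0.
- by apply: r_cont => [z|]; rewrite ?subrr// prod_normE le_max lexx.
- by apply: r_cont => [z|]; rewrite ?subrr// prod_normE le_max lexx orbT.
Qed.

Lemma is_derive_implicit F (g : R -> R) q a b :
  is_gradient F (g q) q a b -> a != 0 -> {for q, continuous g} ->
  (\forall s \near q, F (g s) s = F (g q) q) -> is_derive q 1 g (- b / a).
Proof.
move=> /is_gradient_caratheodory[A [B [AB cA Aa cB Bb]]] a0 cg Fg.
have gq_cvg : (g s, s) @[s --> q] --> (g q, q) by exact: cvg_pair cg cvg_id.
have A_cvg : A (g s, s) @[s --> q] --> a by rewrite -Aa; exact: cvg_comp gq_cvg cA.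
have B_cvg : B (g s, s) @[s --> q] --> b by rewrite -Bb; exact: cvg_comp gq_cvg cB.
pose slope s := if s == q then - b / a else (g s - g q) / (s - q).
apply/is_derive1_caratheodory; exists slope; split; last by rewrite /slope eqxx.
  move=> s; rewrite /slope; case: eqVneq => [->|sq]; first by rewrite !subrr mulr0.
  by rewrite divfK// subr_eq0.
rewrite /prop_for /continuous_at {2}/slope eqxx.
have : - B (g s, s) / A (g s, s) @[s --> q] --> - b / a.
  by apply: cvgM; [exact: cvgN|exact: cvgV].
apply: cvg_trans; apply: near_eq_cvg; near=> s.
have A0 : A (g s, s) != 0 by near: s; exact: (cvgr_neq0 _ A_cvg).
have := AB (g s, s); rewrite /= (near Fg s)// subrr => /eqP.
rewrite eq_sym addr_eq0 => /eqP ABs.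
rewrite /slope; case: eqVneq => [->|sq]; first by rewrite Aa Bb.
have sq0 : s - q != 0 by rewrite subr_eq0.
by rewrite -(mulKf A0 (g s - g q)) ABs; field; rewrite A0 sq0.
Unshelve. all: by end_near. Qed.

End Gradient.

Section MonotoneInverse.
Context {R : realType}.
Implicit Types (f : R -> R) (lo hi v x y : R).

Lemma IVT_near_left f lo hi v : lo < hi -> {within `[lo, hi[, continuous f} ->
  f lo <= v -> (\forall y \near hi^'-, v < f y) ->
  exists2 x, lo <= x < hi & f x = v.
Proof.
move=> lohi cf flo fhi.
have [y [ly yh vy]] : exists y, [/\ lo < y, y < hi & v < f y].
  near hi^'- => y; exists y; split; near: y => //; first exact: nbhs_left_gt.
  exact: nbhs_left_lt.
have [||x xly fx] := @IVT _ f lo y v (ltW ly).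
- by apply: continuous_subspaceW cf; apply: subset_itvl; rewrite bnd_simp.
- by rewrite min_l ?max_r ?flo ?ltW// (le_lt_trans flo).
move: xly; rewrite in_itv/= => /andP[lx xy].
by exists x => //; rewrite lx (le_lt_trans xy).
Unshelve. all: by end_near. Qed.

Lemma is_derive_pinv f (d : R -> R) lo hi x l : {in `]lo, hi[, continuous f} ->
  {in `]lo, hi[ &, injective f} -> x \in `]lo, hi[ -> is_derive x 1 f l -> l != 0 ->
  is_derive (f x) 1 ('pinv_d `]lo, hi[ f) l^-1.
Proof.
move=> cf inj_f xlh dfx l0; apply: is_derive_inverse => //.
  near=> y; apply: pinvKV; last by rewrite inE; near: y; exact: near_in_itvoo.
  by move=> u w; rewrite !inE; exact: inj_f.
by near=> y; apply: cf; near: y; exact: near_in_itvoo.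
Unshelve. all: by end_near. Qed.

End MonotoneInverse.

Section SegmentIntegral.
Context {R : realType}.
Implicit Types (f g F : R -> R) (a b r : R).
Notation mu := (@lebesgue_measure R).

Lemma within_continuousZl (A : set R) r f : {within A, continuous f} ->
  {within A, continuous (fun x => r * f x)}.
Proof. by move=> cf x; apply: cvgM; [exact: cvg_cst|exact: cf]. Qed.

Lemma segment_integrable f a b : {within `[a, b], continuous f} ->
  mu.-integrable `[a, b] (EFin \o f).
Proof. by move=> cf; apply: continuous_compact_integrable => //; exact: segment_compact. Qed.

Lemma segment_RintegralD f g a b :
  {within `[a, b], continuous f} -> {within `[a, b], continuous g} ->
  \int[mu]_(x in `[a, b]) (f x + g x) =
    \int[mu]_(x in `[a, b]) f x + \int[mu]_(x in `[a, b]) g x.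
Proof. by move=> cf cg; apply: RintegralD => //; exact: segment_integrable. Qed.

Lemma segment_RintegralB f g a b :
  {within `[a, b], continuous f} -> {within `[a, b], continuous g} ->
  \int[mu]_(x in `[a, b]) (f x - g x) =
    \int[mu]_(x in `[a, b]) f x - \int[mu]_(x in `[a, b]) g x.
Proof. by move=> cf cg; apply: RintegralB => //; exact: segment_integrable. Qed.

Lemma segment_RintegralZl f r a b : {within `[a, b], continuous f} ->
  \int[mu]_(x in `[a, b]) (r * f x) = r * \int[mu]_(x in `[a, b]) f x.
Proof. by move=> cf; apply: RintegralZl => //; exact: segment_integrable. Qed.

Lemma segment_Rintegral_cst r a b : a <= b ->
  \int[mu]_(x in `[a, b]) r = r * (b - a).
Proof.
move=> ab; rewrite Rintegral_cst//= lebesgue_measure_itv/= lte_fin.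
by case: ltgtP ab => // -> _; rewrite subrr mulr0.
Qed.

Lemma segment_Rintegral_itvoo f a b : {within `[a, b], continuous f} ->
  \int[mu]_(x in `[a, b]) f x = \int[mu]_(x in `]a, b[) f x.
Proof.
move=> cf; have /integrableP[mf _] := segment_integrable cf.
by congr fine; apply: integral_itv_bndoo; apply: measurable_funS mf => //; exact: subset_itv_oo_cc.
Qed.

Lemma segment_le_Rintegral f g a b :
  {within `[a, b], continuous f} -> {within `[a, b], continuous g} ->
  (forall x, a < x < b -> f x <= g x) ->
  \int[mu]_(x in `[a, b]) f x <= \int[mu]_(x in `[a, b]) g x.
Proof.
move=> cf cg fg; rewrite !segment_Rintegral_itvoo//; apply: le_Rintegral => //.
- by apply: integrableS (segment_integrable cf) => //; exact: subset_itv_oo_cc.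
- by apply: integrableS (segment_integrable cg) => //; exact: subset_itv_oo_cc.
Qed.

Lemma segment_normr_Rintegral_le f r a b : a <= b -> {within `[a, b], continuous f} ->
  (forall x, a < x < b -> `|f x| <= r) ->
  `|\int[mu]_(x in `[a, b]) f x| <= r * (b - a).
Proof.
move=> ab cf fr; rewrite -segment_Rintegral_cst//.
apply: le_trans (le_normr_Rintegral _ (segment_integrable cf)) _ => //.
apply: segment_le_Rintegral => //; last exact: cst_continuous.
by move=> x; apply: cvg_norm; exact: cf.
Qed.

Lemma segment_Rintegral_FTC2 f F a b : a < b -> {within `[a, b], continuous f} ->
  {in `[a, b], forall x : R, is_derive x 1 F (f x)} ->
  \int[mu]_(x in `[a, b]) f x = F b - F a.
Proof.
move=> ab cf dF; have [aab bab] : a \in `[a, b] /\ b \in `[a, b].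
  by rewrite !in_itv/= !lexx !ltW.
have cF x : x \in `[a, b] -> {for x, continuous F} by move=> /dF; exact: is_derive_continuous.
rewrite /Rintegral (@continuous_FTC2 _ f F a b)//.
  split; first by move=> x /subset_itv_oo_cc /dF[].
  - by apply: cvg_at_right_filter; exact: cF.
  - by apply: cvg_at_left_filter; exact: cF.
by move=> x /subset_itv_oo_cc /dF[_ <-]; rewrite derive1E.
Qed.

Lemma segment_le_Rintegral_subset f a b c d : {within `[a, b], continuous f} ->
  (forall x, a < x < b -> 0 <= f x) -> a <= c -> d <= b ->
  \int[mu]_(x in `[c, d]) f x <= \int[mu]_(x in `[a, b]) f x.
Proof.
move=> cf f0 ac db.
have cdab : `[c, d] `<=` `[a, b] by apply: subset_itv; rewrite bnd_simp.
have cdabo : `]c, d[ `<=` `]a, b[ by apply: subset_itv; rewrite bnd_simp.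
have intf : mu.-integrable `]a, b[ (EFin \o f).
  by apply: integrableS (segment_integrable cf) => //; exact: subset_itv_oo_cc.
rewrite !segment_Rintegral_itvoo//; last exact: continuous_subspaceW cdab cf.
apply: fine_le; [|exact: integrable_fin_num|].
  by apply: integrable_fin_num => //; exact: integrableS intf.
by apply: ge0_subset_integral => //=; have /integrableP[] := intf.
Qed.

Lemma segment_Rintegral_gt0 f a b c : a < b -> {within `[a, b], continuous f} ->
  (forall x, a < x < b -> 0 <= f x) -> a <= c <= b -> 0 < f c ->
  0 < \int[mu]_(x in `[a, b]) f x.
Proof.
move=> ab cf f0 /[dup] cab /andP[ac cb] fc.
have /subspace_continuousP/(_ c) := cf; rewrite /= in_itv/= => /(_ cab) cfc.
have fc2 : f c / 2 < f c by lra.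
have [e /= e0 fe] := cvgr_ge _ cfc _ fc2.
pose u := Num.max a (c - e / 2); pose v := Num.min b (c + e / 2).
have uv : u < v by rewrite gt_max !lt_min; lra.
have fuv x : u < x < v -> f c / 2 <= f x.
  rewrite gt_max lt_min => /andP[/andP[ax cx] /andP[xb xc]].
  by apply: fe; rewrite /= ?in_itv/= ?ltr_norml; lra.
apply: (@lt_le_trans _ _ (\int[mu]_(x in `[u, v]) f x)).
  apply: (@lt_le_trans _ _ (\int[mu]_(x in `[u, v]) (f c / 2))).
    by rewrite segment_Rintegral_cst ?(ltW uv)// mulr_gt0//; lra.
  apply: segment_le_Rintegral => //; first exact: cst_continuous.
  by apply: continuous_subspaceW cf; apply: subset_itv; rewrite bnd_simp ?le_max ?ge_min lexx.
apply: segment_le_Rintegral_subset => //; rewrite ?le_max ?ge_min lexx//.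
Qed.

Lemma segment_lt_Rintegral f g a b c : a < b ->
  {within `[a, b], continuous f} -> {within `[a, b], continuous g} ->
  (forall x, a < x < b -> f x <= g x) -> a <= c <= b -> f c < g c ->
  \int[mu]_(x in `[a, b]) f x < \int[mu]_(x in `[a, b]) g x.
Proof.
move=> ab cf cg fg cab fgc; rewrite -subr_gt0 -segment_RintegralB//.
apply: (@segment_Rintegral_gt0 _ _ _ c) => //; last by rewrite subr_gt0.
  exact: within_continuousB.
by move=> x /fg; rewrite subr_ge0.
Qed.

End SegmentIntegral.

Section OpenSubstitution.
Context {R : realType}.
Notation mu := (@lebesgue_measure R).

Lemma ge0_cvg_integral_itvoo (g : R -> \bar R) (a b : R) (u v : R^nat) :
  nonincreasing_seq u -> nondecreasing_seq v ->
  (forall n, a < u n) -> (forall n, v n < b) -> u @ \oo --> a -> v @ \oo --> b ->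
  measurable_fun `]a, b[ g -> {in `]a, b[, forall x, 0 <= g x}%E ->
  (\int[mu]_(x in `[u n, v n]) g x)%E @[n --> \oo] --> (\int[mu]_(x in `]a, b[) g x)%E.
Proof.
move=> decu incv au vb ua vb_cvg mg g0.
have uv_sub n : `[u n, v n] `<=` `]a, b[ by apply: subset_itv; rewrite bnd_simp.
have -> : `]a, b[%classic = \bigcup_n `[u n, v n]%classic.
  apply/seteqP; split=> [x /=|x [n _]]; last exact: uv_sub.
  rewrite in_itv/= => /andP[ax xb]; near \oo => n; exists n => //=; rewrite in_itv/=.
  by apply/andP; split; near: n; [exact: cvgr_le ua _ ax|exact: cvgr_ge vb_cvg _ xb].
apply: ge0_nondecreasing_set_cvg_integral => //.
- move=> m n mn; apply/subsetPset/subset_itv; rewrite bnd_simp; first exact: decu.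
  exact: incv.
- by move=> n; apply: measurable_funS mg => //; exact: uv_sub.
- by move=> n x /uv_sub; exact: g0.
Unshelve. all: by end_near. Qed.

Lemma itvoo_exhausting_seq (a b : R) : a < b -> exists u v : R^nat,
  [/\ nonincreasing_seq u, nondecreasing_seq v,
      forall n, [/\ a < u n, u n < v n & v n < b], u @ \oo --> a & v @ \oo --> b].
Proof.
move=> ab; have ba3 : 0 < (b - a) / 3 by rewrite divr_gt0// subr_gt0.
pose h n : R := (b - a) / 3 * harmonic n.
have h0 n : 0 < h n by rewrite mulr_gt0 ?harmonic_gt0.
have h1 n : h n <= (b - a) / 3 by rewrite /h ler_piMr ?(ltW ba3)//= invf_le1 ?ler1n.
have dech : nonincreasing_seq h.
  by move=> m n mn; rewrite ler_pM2l//= lef_pV2 ?posrE// ler_nat.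
have h_cvg : h @ \oo --> 0.
  rewrite -[X in _ --> X](mulr0 ((b - a) / 3)).
  by apply: cvgM; [exact: cvg_cst|exact: cvg_harmonic].
exists (fun n => a + h n), (fun n => b - h n); split.
- by move=> m n mn; rewrite lerD2l dech.
- by move=> m n mn; rewrite lerD2l lerN2 dech.
- by move=> n; have := h0 n; have := h1 n; split; lra.
- by rewrite -[X in _ --> X]addr0; apply: cvgD => //; exact: cvg_cst.
- by rewrite -[X in _ --> X]subr0; apply: cvgB => //; exact: cvg_cst.
Qed.

Section increasing_substitution.
Variables (F f G : R -> R) (a b : R).
Hypothesis ab : a < b.
Hypothesis cF : {within `[a, b], continuous F}.
Hypothesis dF : {in `]a, b[, forall x : R, is_derive x 1 F (f x)}.
Hypothesis cf : {in `]a, b[, continuous f}.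
Hypothesis f0 : {in `]a, b[, forall x, 0 < f x}.
Hypothesis cG : {in `]F a, F b[, continuous G}.
Hypothesis G0 : {in `]F a, F b[, forall y, 0 <= G y}.

Let derive1F x : x \in `]a, b[ -> derive1 F x = f x.
Proof. by move=> /dF[_ <-]; rewrite derive1E. Qed.

Let incF : {in `[a, b] &, {homo F : x y / x < y}}.
Proof.
by apply: gtr0_derive1_lt_cc => // [x /dF[]//|x xab]; rewrite derive1F// f0.
Qed.

Let F_itvoo x : x \in `]a, b[ -> F x \in `]F a, F b[.
Proof. by rewrite !in_itv/= => /andP[ax xb]; rewrite !incF// in_itv/= ?lexx ?ltW. Qed.

Let cFo x : x \in `]a, b[ -> {for x, continuous F}.
Proof. by move=> /dF; exact: is_derive_continuous. Qed.

Let derive1F_cvg x : x \in `]a, b[ -> derive1 F y @[y --> x] --> f x.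
Proof.
move=> xab; apply: cvg_trans (cf xab); apply: near_eq_cvg; near=> y.
by rewrite derive1F//; near: y; exact: near_in_itvoo.
Unshelve. all: by end_near. Qed.

Let integration_by_substitution_itvcc u v : a < u -> u < v -> v < b ->
  (\int[mu]_(y in `[F u, F v]) (G y)%:E = \int[mu]_(x in `[u, v]) (G (F x) * f x)%:E)%E.
Proof.
move=> au uv vb.
have uvab : `[u, v] `<=` `]a, b[ by apply: subset_itv; rewrite bnd_simp.
have uab : u \in `]a, b[ by apply: uvab; rewrite /= bound_itvE ltW.
have vab : v \in `]a, b[ by apply: uvab; rewrite /= bound_itvE ltW.
rewrite (@integration_by_substitution_increasing _ F G u v) ?(ltW uv)//.
- by apply: eq_integral => x; rewrite inE => /uvab xab; rewrite !fctE derive1F.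
- by move=> x y /uvab xab /uvab yab; apply: incF; exact: subset_itv_oo_cc.
- move=> x /subset_itv_oo_cc /uvab xab.
  by rewrite /continuous_at derive1F//; exact: derive1F_cvg.
- by apply/cvg_ex; exists (f u); apply: cvg_at_right_filter; exact: derive1F_cvg.
- by apply/cvg_ex; exists (f v); apply: cvg_at_left_filter; exact: derive1F_cvg.
- split; first by move=> x /subset_itv_oo_cc /uvab /dF[].
  + by apply: cvg_at_right_filter; exact: cFo.
  + by apply: cvg_at_left_filter; exact: cFo.
- apply: continuous_in_subspaceT => y; rewrite inE => Fy; apply: cG.
  move/F_itvoo: uab; move/F_itvoo: vab; move: Fy; rewrite /= !in_itv/=.
  by move=> /andP[uy yv] /andP[_ vb'] /andP[au' _]; rewrite (lt_le_trans au') ?(le_lt_trans yv).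
Qed.

Lemma ge0_integration_by_substitution_itvoo :
  \int[mu]_(y in `]F a, F b[) G y = \int[mu]_(x in `]a, b[) (G (F x) * f x).
Proof.
have [_ Fa Fb] := (continuous_within_itvP _ ab).1 cF.
have [u [v [decu incv uv ua vb]]] := itvoo_exhausting_seq ab.
have uvab n : (u n \in `]a, b[) /\ (v n \in `]a, b[).
  by rewrite !in_itv/=; have [] := uv n; split; lra.
have incFw : {in `]a, b[ &, {homo F : x y / x <= y}}.
  by move=> x y xab yab; rewrite le_eqVlt => /predU1P[->//|xy]; apply/ltW/incF => //;
    exact: subset_itv_oo_cc.
have open_measurable (c d : R) (g : R -> R) : {in `]c, d[, continuous g} ->
    measurable_fun `]c, d[ (EFin \o g).
  move=> cg; apply/measurable_EFinP; apply: open_continuous_measurable_fun => //.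
  by move=> x; rewrite inE; exact: cg.
have int_GF : (\int[mu]_(x in `[u n, v n]) (G (F x) * f x)%:E)%E @[n --> \oo] -->
    (\int[mu]_(x in `]a, b[) (G (F x) * f x)%:E)%E.
  apply: ge0_cvg_integral_itvoo => //; try by move=> n; have [] := uv n.
    apply: open_measurable => x xab; apply: cvgM; last exact: cf.
    by apply: (@continuous_comp _ _ _ F G); [exact: cFo|exact/cG/F_itvoo].
  by move=> x xab; rewrite lee_fin mulr_ge0 ?G0 ?F_itvoo// ltW ?f0.
have int_G : (\int[mu]_(y in `[F (u n), F (v n)]) (G y)%:E)%E @[n --> \oo] -->
    (\int[mu]_(y in `]F a, F b[) (G y)%:E)%E.
  apply: ge0_cvg_integral_itvoo.
  - by move=> m n mn; apply: incFw; rewrite ?(uvab _).1//; exact: decu.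
  - by move=> m n mn; apply: incFw; rewrite ?(uvab _).2//; exact: incv.
  - by move=> n; have /F_itvoo := (uvab n).1; rewrite in_itv => /andP[].
  - by move=> n; have /F_itvoo := (uvab n).2; rewrite in_itv => /andP[].
  - by move/cvg_at_rightP: Fa; apply; split => // n; have [] := uv n.
  - by move/cvg_at_leftP: Fb; apply; split => // n; have [] := uv n.
  - exact: open_measurable.
  - by move=> y yab; rewrite lee_fin G0.
congr fine; apply: cvg_unique int_G _ => //.
apply: cvg_trans int_GF; apply: near_eq_cvg; near=> n.
by rewrite integration_by_substitution_itvcc//; have [] := uv n.
Unshelve. all: by end_near. Qed.

End increasing_substitution.

End OpenSubstitution.

Section Transport.
Context {R : realType}.
Implicit Types (u c : R -> R -> R) (V : R -> R) (k l x t : R).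

Lemma transport_cst k c x t : transport_at (fun _ _ => k) c x t.
Proof.
by do 2?[split; first exact: derivable_cst]; rewrite !derive1_cst mulr0 addr0.
Qed.

Lemma transport_selfsimilar u c V x t l : 0 < t ->
  (forall y s, 0 < s -> u y s = V (y / s)) -> is_derive (x / t) 1 V l ->
  l = 0 \/ c x t = x / t -> transport_at u c x t.
Proof.
move=> t0 uV dV l0c; have t1 : t != 0 by rewrite gt_eqF.
have dx : is_derive x 1 (fun y => u y t) (l / t).
  rewrite (_ : (fun y => u y t) = V \o (fun y => y / t)); last by apply/funext => y; exact: uV.
  apply: is_derive1_comp; apply: is_derive_eq; rewrite /GRing.scale/=; ring.
have dt : is_derive t 1 (u x) (l * (- x / t ^+ 2)).
  apply: (near_eq_is_derive (f := V \o (fun s => x / s))).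
    by near=> s; rewrite uV//; near: s; exact: lt_nbhsr.
  have dq : is_derive t 1 (fun s => x / s) (- x / t ^+ 2).
    apply: is_derive_eq.
      exact: is_deriveM (is_derive_cst x t 1) (@is_deriveV _ id _ _ _ t1 (is_derive_id t 1)).
    by rewrite /GRing.scale/=; field.
  exact: is_derive1_comp.
split; first by case: dx.
split; first by case: dt.
rewrite !derive1E; have [[_ ->] [_ ->]] := (dx, dt).
by case: l0c => ->; [rewrite !mul0r mulr0 addr0|field].
Unshelve. all: by end_near. Qed.

Lemma ratio_cvg_at_right t k : 0 < t -> x / t @[x --> (t * k)^'+] --> k^'+.
Proof.
move=> t0 S [d /= d0 dS]; exists (d * t); first by rewrite /= mulr_gt0.
move=> x /= xd xk; apply: dS => /=; last by rewrite ltr_pdivlMr// mulrC.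
have -> : k - x / t = (t * k - x) / t by field; rewrite gt_eqF.
by rewrite normrM normfV (gtr0_norm t0) ltr_pdivrMr.
Qed.

Lemma ratio_cvg_at_left t k : 0 < t -> x / t @[x --> (t * k)^'-] --> k^'-.
Proof.
move=> t0 S [d /= d0 dS]; exists (d * t); first by rewrite /= mulr_gt0.
move=> x /= xd xk; apply: dS => /=; last by rewrite ltr_pdivrMr// mulrC.
have -> : k - x / t = (t * k - x) / t by field; rewrite gt_eqF.
by rewrite normrM normfV (gtr0_norm t0) ltr_pdivrMr.
Qed.

Lemma step_is_derive k (a b xi : R) : xi != k ->
  is_derive xi 1 (fun z => if z <= k then a else b) 0.
Proof.
rewrite neq_lt => /orP[xik|kxi].
  apply: near_eq_is_derive (is_derive_cst a xi 1).
  by apply: filterS (lt_nbhsl xik) => z /ltW->.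
apply: near_eq_is_derive (is_derive_cst b xi 1).
by apply: filterS (lt_nbhsr kxi) => z kz; rewrite leNgt kz.
Qed.

Lemma burgers_outerE (nu a b : R) x t : 0 < t ->
  burgers_outer nu a b x t = if x / t <= (3 * a - nu) / 4 then a else b.
Proof. by move=> t0; rewrite /burgers_outer gt_eqF. Qed.

Lemma burgers_outer_initial (nu a b : R) x :
  (x < 0 -> burgers_outer nu a b x 0 = a) /\ (0 < x -> burgers_outer nu a b x 0 = b).
Proof. by rewrite /burgers_outer eqxx; case: ltgtP. Qed.

Lemma burgers_outer_transport (nu a b : R) c x t : 0 < t ->
  x / t != (3 * a - nu) / 4 -> transport_at (burgers_outer nu a b) c x t.
Proof.
move=> t0 xik; apply: (transport_selfsimilar t0 _ (step_is_derive a b xik)); last by left.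
exact: burgers_outerE.
Qed.

End Transport.

Section TrigonometricMean.
Context {R : realType}.
Implicit Types (f g : R -> R) (m n : nat) (p q r x y : R).
Notation mu := (@lebesgue_measure R).

Definition trigseg p q x : R := p * sin x ^+ 2 + q * cos x ^+ 2.

Definition trigweight m n x : R := (sin x ^+ 2) ^+ m * (cos x ^+ 2) ^+ n.

Definition trigmean m n f p q : R :=
  \int[mu]_(x in `[0, pi / 2]) (f (trigseg p q x) * trigweight m n x).

Lemma pihalf_gt0 : 0 < pi / 2 :> R.
Proof. by rewrite divr_gt0 ?pi_gt0. Qed.

Lemma sin_cos_pihalf_gt0 x : 0 < x < pi / 2 -> 0 < sin x /\ 0 < cos x.
Proof.
move=> /andP[x0 xpi]; split; first by rewrite sin_gt0_pihalf// x0.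
by rewrite cos_gt0_pihalf// xpi (lt_trans _ x0)// oppr_lt0 pihalf_gt0.
Qed.

Lemma trigseg0 p q : trigseg p q 0 = q.
Proof. by rewrite /trigseg sin0 cos0; ring. Qed.

Lemma trigseg_pihalf p q : trigseg p q (pi / 2) = p.
Proof. by rewrite /trigseg sin_pihalf cos_pihalf; ring. Qed.

Lemma trigsegE p q x : trigseg p q x = q + (p - q) * sin x ^+ 2.
Proof. by rewrite /trigseg cos2sin2; ring. Qed.

Lemma is_derive_trigseg p q x :
  is_derive x 1 (trigseg p q) (2 * (p - q) * (sin x * cos x)).
Proof. by apply: is_derive_eq; rewrite /GRing.scale/=; ring. Qed.

Lemma continuous_trigseg p q : continuous (trigseg p q).
Proof. by move=> x; exact: is_derive_continuous (is_derive_trigseg p q x). Qed.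

Lemma trigseg_itv (i : interval R) p q x : p \in i -> q \in i -> trigseg p q x \in i.
Proof.
have segP u v : u <= v -> u <= trigseg u v x <= v /\ u <= trigseg v u x <= v.
  move=> uv; have := cos2Dsin2 x; rewrite /trigseg.
  have := mulr_ge0 (_ : 0 <= v - u) (sqr_ge0 (sin x)).
  have := mulr_ge0 (_ : 0 <= v - u) (sqr_ge0 (cos x)).
  rewrite subr_ge0 => /(_ uv) + /(_ uv) + cs.
  have -> : sin x ^+ 2 = 1 - cos x ^+ 2 by rewrite -cs; ring.
  by move=> cos_scaled sin_scaled; split; lra.
move=> pi_ qi; have [pq|/ltW qp] := leP p q.
  exact: (interval_is_interval pi_ qi (segP _ _ pq).1).
exact: (interval_is_interval qi pi_ (segP _ _ qp).2).
Qed.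

Lemma norm_trigsegB_le (z w : R * R) x :
  `|trigseg z.1 z.2 x - trigseg w.1 w.2 x| <= `|z - w|.
Proof.
have -> : trigseg z.1 z.2 x - trigseg w.1 w.2 x = trigseg (z.1 - w.1) (z.2 - w.2) x.
  by rewrite /trigseg; ring.
have : trigseg (z.1 - w.1) (z.2 - w.2) x \in `[- `|z - w|, `|z - w| ].
  apply: trigseg_itv; rewrite in_itv/= -ler_norml prod_normE/= le_max lexx ?orbT//.
by rewrite in_itv/= -ler_norml.
Qed.

Lemma trigseg_lt p q r x : 0 < x < pi / 2 -> p <= r -> q < r -> trigseg p q x < r.
Proof.
move=> /sin_cos_pihalf_gt0[s0 c0] pr qr.
have -> : r = r * sin x ^+ 2 + r * cos x ^+ 2 by rewrite -mulrDr addrC cos2Dsin2 mulr1.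
by rewrite ler_ltD// ?ler_pM2r ?ltr_pM2r// exprn_gt0.
Qed.

Lemma continuous_trigweight m n : continuous (trigweight m n).
Proof.
have contX f k : continuous f -> continuous (fun x => f x ^+ k).
  move=> cf x; apply: (@continuous_comp _ _ _ f (fun y => y ^+ k)); first exact: cf.
  exact: exprn_continuous.
move=> x; apply: cvgM.
  exact: (contX _ m (contX _ 2 (@continuous_sin R))).
exact: (contX _ n (contX _ 2 (@continuous_cos R))).
Qed.

Lemma trigweight_gt0 m n x : 0 < x < pi / 2 -> 0 < trigweight m n x.
Proof. by move=> /sin_cos_pihalf_gt0[s0 c0]; rewrite mulr_gt0 ?exprn_gt0. Qed.

Lemma trigweight_itv m n x : 0 <= trigweight m n x <= 1.
Proof.
have := cos2Dsin2 x; have := sqr_ge0 (sin x); have := sqr_ge0 (cos x); rewrite /trigweight.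
move: (sin x ^+ 2) (cos x ^+ 2) => s c c0 s0 sc.
rewrite mulr_ge0 ?exprn_ge0// mulr_ile1 ?exprn_ge0 ?exprn_ile1//; lra.
Qed.

Lemma trigweightSl m n x : trigweight m.+1 n x = sin x ^+ 2 * trigweight m n x.
Proof. by rewrite /trigweight [_ ^+ m.+1]exprS mulrA. Qed.

Lemma trigweightSr m n x : trigweight m n.+1 x = cos x ^+ 2 * trigweight m n x.
Proof. by rewrite /trigweight [_ ^+ n.+1]exprS mulrCA. Qed.

Section averages_on_interval.
Variables lo hi : R.

Lemma trigmean_integrand_continuous A f m n p q :
  {in `]lo, hi[, continuous f} -> p \in `]lo, hi[ -> q \in `]lo, hi[ ->
  {within A, continuous (fun x => f (trigseg p q x) * trigweight m n x)}.
Proof.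
move=> cf plh qlh; apply: continuous_subspaceT => x; apply: cvgM; last exact: continuous_trigweight.
apply: (@continuous_comp _ _ _ (trigseg p q) f); first exact: continuous_trigseg.
exact/cf/trigseg_itv.
Qed.

Lemma trigmean_lt f g m n p q p' q' :
  {in `]lo, hi[, continuous f} -> {in `]lo, hi[, continuous g} ->
  p \in `]lo, hi[ -> q \in `]lo, hi[ -> p' \in `]lo, hi[ -> q' \in `]lo, hi[ ->
  (forall x, 0 < x < pi / 2 -> f (trigseg p q x) < g (trigseg p' q' x)) ->
  trigmean m n f p q < trigmean m n g p' q'.
Proof.
move=> cf cg plh qlh plh' qlh' fg; have pi0 := pi_gt0 R.
apply: (@segment_lt_Rintegral _ _ _ _ _ (pi / 4)); first exact: pihalf_gt0.
- exact: trigmean_integrand_continuous.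
- exact: trigmean_integrand_continuous.
- by move=> x x0; rewrite ler_pM2r ?trigweight_gt0// ltW ?fg.
- by lra.
- by rewrite ltr_pM2r ?trigweight_gt0 ?fg//; lra.
Qed.

Lemma trigmean_le_affine f g m n k l p q r s :
  {in `]lo, hi[, continuous f} -> {in `]lo, hi[, continuous g} ->
  p \in `]lo, hi[ -> q \in `]lo, hi[ ->
  (forall x, 0 < x < pi / 2 -> f (trigseg p q x) * trigweight m n x <=
    r * (g (trigseg p q x) * trigweight k l x) + s) ->
  trigmean m n f p q <= r * trigmean k l g p q + s * (pi / 2).
Proof.
move=> cf cg plh qlh fg.
have cint := trigmean_integrand_continuous (A := `[0, pi / 2]) (m := k) (n := l) cg plh qlh.
have crint := within_continuousZl (r := r) cint.
have cs : {within `[0, pi / 2], continuous (cst s : R -> R)} by exact: cst_continuous.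
rewrite -[pi / 2]subr0 -segment_Rintegral_cst ?(ltW pihalf_gt0)//.
rewrite -segment_RintegralZl// -segment_RintegralD//.
apply: segment_le_Rintegral => //; first exact: trigmean_integrand_continuous.
exact: within_continuousD.
Qed.

Lemma trigmeanSD f m n p q :
  {in `]lo, hi[, continuous f} -> p \in `]lo, hi[ -> q \in `]lo, hi[ ->
  trigmean m.+1 n f p q + trigmean m n.+1 f p q = trigmean m n f p q.
Proof.
move=> cf plh qlh; rewrite /trigmean -segment_RintegralD; first last.
- exact: trigmean_integrand_continuous.
- exact: trigmean_integrand_continuous.
apply: eq_Rintegral => x _; rewrite trigweightSl trigweightSr -mulrDr -mulrDl.
by rewrite [_ + cos x ^+ 2]addrC cos2Dsin2 mul1r.
Qed.

Lemma trigmean_cst m n r p q : trigmean m n (cst r) p q = r * trigmean m n (cst 1) p q.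
Proof.
rewrite /trigmean -segment_RintegralZl; last first.
  by apply: continuous_subspaceT => x; apply: cvgM; [exact: cvg_cst|exact: continuous_trigweight].
by apply: eq_Rintegral => x _; rewrite mul1r.
Qed.

Lemma trigmean_diag f m n y : trigmean m n f y y = f y * trigmean m n (cst 1) y y.
Proof.
rewrite -trigmean_cst; apply: eq_Rintegral => x _.
by rewrite /trigseg -mulrDr addrC cos2Dsin2 mulr1.
Qed.

Lemma trigmean_gt0 f m n p q : {in `]lo, hi[, continuous f} ->
  p \in `]lo, hi[ -> q \in `]lo, hi[ ->
  (forall x, 0 < x < pi / 2 -> 0 < f (trigseg p q x)) -> 0 < trigmean m n f p q.
Proof.
move=> cf plh qlh f0; rewrite -[X in X < _](mul0r (trigmean m n (cst 1) p q)) -trigmean_cst.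
by apply: trigmean_lt => // x _; exact: cst_continuous.
Qed.

Lemma trigmean_lt0 f m n p q : {in `]lo, hi[, continuous f} ->
  p \in `]lo, hi[ -> q \in `]lo, hi[ ->
  (forall x, 0 < x < pi / 2 -> f (trigseg p q x) < 0) -> trigmean m n f p q < 0.
Proof.
move=> cf plh qlh f0; rewrite -[X in _ < X](mul0r (trigmean m n (cst 1) p q)) -trigmean_cst.
by apply: trigmean_lt => // x _; exact: cst_continuous.
Qed.

Lemma trigmean_increasing f m n p p' q : {in `]lo, hi[, continuous f} ->
  {in `]lo, hi[ &, {homo f : x y / x < y}} ->
  p \in `]lo, hi[ -> p' \in `]lo, hi[ -> q \in `]lo, hi[ -> p < p' ->
  trigmean m n f p q < trigmean m n f p' q.
Proof.
move=> cf incf plh plh' qlh pp'; apply: trigmean_lt => // x xpi.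
apply: incf; try exact: trigseg_itv.
by rewrite ltrD2r ltr_pM2r// exprn_gt0//; have [] := sin_cos_pihalf_gt0 xpi.
Qed.

Section continuously_differentiable.
Variables f df : R -> R.
Hypothesis f_df : {in `]lo, hi[, forall y : R, is_derive y 1 f (df y)}.
Hypothesis cdf : {in `]lo, hi[, continuous df}.

Let cf : {in `]lo, hi[, continuous f}.
Proof. by move=> y /f_df; exact: is_derive_continuous. Qed.

Let integrand_continuous (A : set R) m n p q : p \in `]lo, hi[ -> q \in `]lo, hi[ ->
  {within A, continuous (fun x => f (trigseg p q x) * trigweight m n x)} /\
  {within A, continuous (fun x => df (trigseg p q x) * trigweight m n x)}.
Proof. by move=> plh qlh; split; exact: trigmean_integrand_continuous. Qed.

Let is_derive_trigseg_comp p q x : p \in `]lo, hi[ -> q \in `]lo, hi[ ->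
  is_derive x 1 (f \o trigseg p q) (df (trigseg p q x) * (2 * (p - q) * (sin x * cos x))).
Proof.
move=> plh qlh; apply: is_derive1_comp; last exact: is_derive_trigseg.
exact/f_df/trigseg_itv.
Qed.

Lemma trigmean_Euler_Poisson_Darboux m n p q : p \in `]lo, hi[ -> q \in `]lo, hi[ ->
  (n.*2.+1)%:R * trigmean m.+1 n f p q - (m.*2.+1)%:R * trigmean m n.+1 f p q =
    2 * (p - q) * trigmean m.+1 n.+1 df p q.
Proof.
move=> plh qlh.
have cint k l := (integrand_continuous `[0, pi / 2] k l plh qlh).1.
have cdint k l := (integrand_continuous `[0, pi / 2] k l plh qlh).2.
pose h : R -> R := (f \o trigseg p q) * (sin ^+ m.*2.+1 * cos ^+ n.*2.+1).
have dh (x : R) : is_derive x 1 h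
    (2 * (p - q) * (df (trigseg p q x) * trigweight m.+1 n.+1 x) +
     ((m.*2.+1)%:R * (f (trigseg p q x) * trigweight m n.+1 x) -
      (n.*2.+1)%:R * (f (trigseg p q x) * trigweight m.+1 n x))).
  have dsin := is_deriveX (f := sin) m.*2.+1 (is_derive_sin x).
  have dcos := is_deriveX (f := cos) n.*2.+1 (is_derive_cos x).
  apply: (is_derive_eq (is_deriveM (is_derive_trigseg_comp x plh qlh) (is_deriveM dsin dcos))).
  rewrite /trigweight !fctE /GRing.scale/= [sin x ^+ m.*2.+1]exprS [cos x ^+ n.*2.+1]exprS.
  by rewrite -!mul2n !exprM (exprS (sin x ^+ 2)) (exprS (cos x ^+ 2)); ring.
suff : 2 * (p - q) * trigmean m.+1 n.+1 df p q +
    ((m.*2.+1)%:R * trigmean m n.+1 f p q - (n.*2.+1)%:R * trigmean m.+1 n f p q) = 0 by lra.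
have rint_cont r k l := within_continuousZl (r := r) (cint k l).
have rdint_cont r k l := within_continuousZl (r := r) (cdint k l).
rewrite /trigmean -!segment_RintegralZl// -segment_RintegralB// -segment_RintegralD//; last first.
  exact: within_continuousB.
rewrite (segment_Rintegral_FTC2 (F := h)) ?pihalf_gt0//.
  by rewrite /h !fctE sin0 cos_pihalf !expr0n/=; ring.
by apply: within_continuousD; [|exact: within_continuousB].
Qed.

(* f p is the increment over [0, pi / 2] of f (trigseg p q x) * sin x. *)
Lemma trigmean_ge_endpoint p q :
  {in `]lo, hi[, forall y, 0 <= f y} -> {in `]lo, hi[, forall y, 0 <= df y} ->
  p \in `]lo, hi[ -> q \in `]lo, hi[ -> q <= p ->
  f p <= trigmean 0 0 f p q + 2 * (p - q) * trigmean 1 0 df p q.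
Proof.
move=> f0 df0 plh qlh qp.
have [cE _] := integrand_continuous `[0, pi / 2] 0 0 plh qlh.
have [_ cdf_int] := integrand_continuous `[0, pi / 2] 1 0 plh qlh.
have cdE := within_continuousZl (r := 2 * (p - q)) cdf_int.
pose h : R -> R := (f \o trigseg p q) * sin.
pose g x := f (trigseg p q x) * trigweight 0 0 x +
  2 * (p - q) * (df (trigseg p q x) * trigweight 1 0 x).
have cg : {within `[0, pi / 2], continuous g} by exact: within_continuousD.
have cgcos : {within `[0, pi / 2], continuous (fun x => g x * cos x)}.
  by move=> x; apply: cvgM; [exact: cg|apply: continuous_subspaceT; exact: continuous_cos].
have dh (x : R) : is_derive x 1 h (g x * cos x).
  apply: (is_derive_eq (is_deriveM (is_derive_trigseg_comp x plh qlh) (is_derive_sin x))).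
  by rewrite /GRing.scale/= /g /trigweight; ring.
have -> : f p = \int[mu]_(x in `[0, pi / 2]) (g x * cos x).
  rewrite (segment_Rintegral_FTC2 (F := h)) ?pihalf_gt0//.
  by rewrite /h !fctE/= trigseg_pihalf sin_pihalf sin0; ring.
rewrite /trigmean -segment_RintegralZl// -segment_RintegralD//.
apply: segment_le_Rintegral => // x xpi.
have slh := trigseg_itv x plh qlh.
have w0 m n : 0 <= trigweight m n x by have /andP[] := trigweight_itv m n x.
apply: ler_piMr (cos_le1 x); rewrite addr_ge0 ?(mulr_ge0 (f0 _ slh))//.
by rewrite mulr_ge0 ?(mulr_ge0 (df0 _ slh))// mulr_ge0 ?subr_ge0.
Qed.

Let near_linear_approx p q e : p \in `]lo, hi[ -> q \in `]lo, hi[ -> 0 < e ->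
  \forall z \near (p, q), {in `[0, pi / 2], forall x,
    `|f (trigseg z.1 z.2 x) - f (trigseg p q x) -
      df (trigseg p q x) * (trigseg z.1 z.2 x - trigseg p q x)| <= e * `|z - (p, q)| }.
Proof.
move=> plh qlh e0; pose arc := trigseg p q @` `[0, pi / 2].
have arc_compact : compact arc.
  apply: continuous_compact; last exact: segment_compact.
  by apply: continuous_subspaceT; exact: continuous_trigseg.
have arc_lh : arc `<=` `]lo, hi[ by move=> _ [x _ <-]; exact: trigseg_itv.
have [d /= d0 near_arc] := near_uniform_linear_approx f_df cdf arc_compact arc_lh e0.
exists (ball p d, ball q d) => [|z zpq x x0pi]; first by split; exact: nbhsx_ballx.
have zd : `|z - (p, q)| < d.
  by move: zpq => []; rewrite /ball/= prod_normE gt_max distrC => -> /=; rewrite distrC.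
have segz := norm_trigsegB_le z (p, q) x.
have seg_d : `|0 - (trigseg z.1 z.2 x - trigseg p q x)| < d.
  by rewrite sub0r normrN; exact: le_lt_trans segz zd.
have arcx : arc (trigseg p q x) by exists x.
have := near_arc _ seg_d _ arcx; rewrite /= subrK => /le_trans; apply.
by rewrite ler_wpM2l// ltW.
Qed.

Lemma trigmean_is_gradient m n p q : p \in `]lo, hi[ -> q \in `]lo, hi[ ->
  is_gradient (trigmean m n f) p q (trigmean m.+1 n df p q) (trigmean m n.+1 df p q).
Proof.
move=> plh qlh; apply/is_gradientP => e e0; have e2 : 0 < e / 2 by rewrite divr_gt0.
have near_lh : \forall z \near (p, q), (z.1 \in `]lo, hi[) /\ (z.2 \in `]lo, hi[).
  by exists (`]lo, hi[%classic, `]lo, hi[%classic) => //; split; exact: near_in_itvoo.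
apply: filterS _ (filterI near_lh (near_linear_approx plh qlh e2)) => z [[z1lh z2lh] fz].
have cint k l := (integrand_continuous `[0, pi / 2] k l plh qlh).1.
have cdint k l := (integrand_continuous `[0, pi / 2] k l plh qlh).2.
have czint k l := (integrand_continuous `[0, pi / 2] k l z1lh z2lh).1.
have cdint1 := within_continuousZl (r := z.1 - p) (cdint m.+1 n).
have cdint2 := within_continuousZl (r := z.2 - q) (cdint m n.+1).
rewrite /trigmean !(mulrC _ (_ - _)) -!segment_RintegralZl// -segment_RintegralB//.
rewrite -segment_RintegralD// -segment_RintegralB;
  [|exact: within_continuousB|exact: within_continuousD].
apply: (@le_trans _ _ (e / 2 * `|z - (p, q)| * (pi / 2 - 0))); last first.
  rewrite subr0 mulrAC ler_wpM2r//.
  by rewrite -[leRHS](divfK (_ : 2 != 0)) ?pnatr_eq0// ler_pM2l// ltW// pihalf_lt2.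
apply: segment_normr_Rintegral_le; first exact/ltW/pihalf_gt0.
  by apply: within_continuousB; [exact: within_continuousB|exact: within_continuousD].
move=> x xpi; have /fz fzx : x \in `[0, pi / 2] by rewrite in_itv/= !ltW; case/andP: xpi.
have -> : f (trigseg z.1 z.2 x) * trigweight m n x - f (trigseg p q x) * trigweight m n x -
    ((z.1 - p) * (df (trigseg p q x) * trigweight m.+1 n x) +
     (z.2 - q) * (df (trigseg p q x) * trigweight m n.+1 x)) =
    (f (trigseg z.1 z.2 x) - f (trigseg p q x) -
     df (trigseg p q x) * (trigseg z.1 z.2 x - trigseg p q x)) * trigweight m n x.
  by rewrite trigweightSl trigweightSr /trigseg; ring.
have /andP[w0 w1] := trigweight_itv m n x.
by rewrite normrM (ger0_norm w0) (le_trans _ fzx)// ler_piMr.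
Qed.

End continuously_differentiable.
End averages_on_interval.
End TrigonometricMean.

Section Weight.
Context {R : realType}.
Variables nu a : R.
Implicit Type y : R.

Definition phi y : R := Num.sqrt ((y + nu) / (a - y)).

Definition dphi y : R := phi y * ((a + nu) / (2 * ((y + nu) * (a - y)))).

Definition d2phi y : R :=
  phi y * ((a + nu) * (4 * y + 3 * nu - a) / (4 * ((y + nu) * (a - y)) ^+ 2)).

Definition d3phi y : R :=
  phi y * (3 * (a + nu) * (4 * (y + nu) ^+ 2 + (2 * y + nu - a) ^+ 2) /
    (8 * ((y + nu) * (a - y)) ^+ 3)).

Lemma phi_gt0 y : - nu < y < a -> 0 < phi y.
Proof. by move=> ya; rewrite sqrtr_gt0 divr_gt0//; lra. Qed.

Lemma sqr_phi y : - nu < y < a -> phi y ^+ 2 = (y + nu) / (a - y).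
Proof. by move=> ya; rewrite sqr_sqrtr// divr_ge0//; lra. Qed.

Lemma is_derive_phiM (g : R -> R) y dg : - nu < y < a -> is_derive y 1 g dg ->
  is_derive y 1 (fun z => phi z * g z)
    (phi y * ((a + nu) / (2 * ((y + nu) * (a - y))) * g y + dg)).
Proof.
move=> ya g_dg; have ynu : y + nu != 0 by rewrite gt_eqF//; lra.
have ay : a - y != 0 by rewrite gt_eqF//; lra.
have phi0 : phi y != 0 by rewrite gt_eqF ?phi_gt0.
pose ratio z := (z + nu) / (a - z).
have ratio_gt0 : 0 < ratio y by rewrite divr_gt0//; lra.
have ratio_deriv : is_derive y 1 ratio ((a + nu) / (a - y) ^+ 2).
  by apply: is_derive_eq; rewrite /GRing.scale/=; field.
have dsqrt := is_derive1_comp (is_derive1_sqrt ratio_gt0) ratio_deriv.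
apply: (is_derive_eq (is_deriveM dsqrt g_dg)); rewrite /GRing.scale/= -/(phi y).
have -> : (2 * phi y)^-1 = phi y * (a - y) / (2 * (y + nu)).
  by apply: (mulfI phi0); rewrite !mulrA -expr2 sqr_phi//; field; rewrite phi0 ynu ay.
by field; rewrite ynu ay.
Qed.

Lemma is_derive_phi y : - nu < y < a -> is_derive y 1 phi (dphi y).
Proof.
move=> ya; have := is_derive_phiM ya (is_derive_cst (1 : R) y 1).
under eq_fun do rewrite mulr1.
by move=> phi_deriv; apply: is_derive_eq; rewrite /dphi mulr1 addr0.
Qed.

Lemma is_derive_dphi y : - nu < y < a -> is_derive y 1 dphi (d2phi y).
Proof.
move=> ya; have ynu : y + nu != 0 by rewrite gt_eqF//; lra.
have ay : a - y != 0 by rewrite gt_eqF//; lra.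
have w0 : 2 * ((y + nu) * (a - y)) != 0 by rewrite !mulf_neq0.
have g_deriv : is_derive y 1 (fun z => (a + nu) / (2 * ((z + nu) * (a - z))))
    ((a + nu) * (2 * y + nu - a) / (2 * ((y + nu) * (a - y)) ^+ 2)).
  by apply: is_derive_eq; rewrite /GRing.scale/=; field; rewrite ynu ay.
apply: (is_derive_eq (is_derive_phiM ya g_deriv)).
by rewrite /d2phi; field; rewrite ynu ay.
Qed.

Lemma is_derive_d2phi y : - nu < y < a -> is_derive y 1 d2phi (d3phi y).
Proof.
move=> ya; have ynu : y + nu != 0 by rewrite gt_eqF//; lra.
have ay : a - y != 0 by rewrite gt_eqF//; lra.
have w0 : 4 * ((y + nu) * (a - y)) ^+ 2 != 0 by rewrite !mulf_neq0.
have g_deriv : is_derive y 1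
    (fun z => (a + nu) * (4 * z + 3 * nu - a) / (4 * ((z + nu) * (a - z)) ^+ 2))
    ((a + nu) * (4 * ((y + nu) * (a - y)) + 2 * (4 * y + 3 * nu - a) * (2 * y + nu - a))
      / (4 * ((y + nu) * (a - y)) ^+ 3)).
  by apply: is_derive_eq; rewrite /GRing.scale/=; field; rewrite ynu ay.
apply: (is_derive_eq (is_derive_phiM ya g_deriv)).
by rewrite /d3phi; field; rewrite ynu ay.
Qed.

Lemma continuous_phi : {in `]- nu, a[, continuous phi}.
Proof. by move=> y /is_derive_phi; exact: is_derive_continuous. Qed.

Lemma continuous_dphi : {in `]- nu, a[, continuous dphi}.
Proof. by move=> y /is_derive_dphi; exact: is_derive_continuous. Qed.

Lemma continuous_d2phi : {in `]- nu, a[, continuous d2phi}.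
Proof. by move=> y /is_derive_d2phi; exact: is_derive_continuous. Qed.

Lemma continuous_d3phi : {in `]- nu, a[, continuous d3phi}.
Proof.
move=> y yna; have /andP[ynu ya] : - nu < y < a by rewrite in_itv in yna.
have w0 : 8 * ((y + nu) * (a - y)) ^+ 3 != 0.
  by rewrite mulf_neq0 ?expf_neq0 ?mulf_neq0 ?gt_eqF//; lra.
apply: cvgM; first exact: continuous_phi.
apply: (@differentiable_continuous _ _ _ _ (fun z =>
  3 * (a + nu) * (4 * (z + nu) ^+ 2 + (2 * z + nu - a) ^+ 2) / (8 * ((z + nu) * (a - z)) ^+ 3))).
by apply/derivable1_diffP.
Qed.

Lemma dphi_gt0 y : - nu < y < a -> 0 < dphi y.
Proof.
move=> ya; rewrite mulr_gt0 ?phi_gt0// divr_gt0 ?mulr_gt0//; lra.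
Qed.

Lemma dphiE y : - nu < y < a -> 2 * ((y + nu) * (a - y)) * dphi y = (a + nu) * phi y.
Proof.
by move=> ya; rewrite /dphi; field; rewrite !gt_eqF//; lra.
Qed.

Lemma phi_le_dphi y : - nu < y < a -> phi y <= 2 * (a - y) * dphi y.
Proof.
move=> ya; have ynu : 0 < y + nu by lra.
rewrite -(ler_pM2l ynu) [leRHS](_ : _ = (a + nu) * phi y); last by rewrite -dphiE//; ring.
by rewrite ler_pM2r ?phi_gt0//; lra.
Qed.

Lemma d2phi_gt0 y : - nu < y < a -> (a - 3 * nu) / 4 < y -> 0 < d2phi y.
Proof.
move=> ya yc; rewrite mulr_gt0 ?phi_gt0// divr_gt0 ?mulr_gt0 ?exprn_gt0 ?mulr_gt0//; lra.
Qed.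

Lemma d2phi_lt0 y : - nu < y < a -> y < (a - 3 * nu) / 4 -> d2phi y < 0.
Proof.
move=> ya yc; rewrite pmulr_rlt0 ?phi_gt0// pmulr_llt0 ?invr_gt0.
  by rewrite pmulr_rlt0; lra.
by rewrite mulr_gt0 ?exprn_gt0 ?mulr_gt0//; lra.
Qed.

Lemma d3phi_gt0 y : - nu < y < a -> 0 < d3phi y.
Proof.
move=> ya; rewrite mulr_gt0 ?phi_gt0// divr_gt0//.
  by rewrite mulr_gt0 ?ltr_wpDr ?sqr_ge0 ?mulr_gt0 ?exprn_gt0//; lra.
by rewrite mulr_gt0 ?exprn_gt0 ?mulr_gt0//; lra.
Qed.

Lemma phi_increasing : {in `]- nu, a[ &, {homo phi : y z / y < z}}.
Proof.
apply: gtr0_derive1_lt_oo; last by move=> y; rewrite inE; exact: continuous_phi.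
  by move=> y /is_derive_phi[].
by move=> y yna; rewrite derive1E; have [_ ->] := is_derive_phi yna; exact: dphi_gt0.
Qed.

Lemma d2phi_increasing : {in `]- nu, a[ &, {homo d2phi : y z / y < z}}.
Proof.
apply: gtr0_derive1_lt_oo; last by move=> y; rewrite inE; exact: continuous_d2phi.
  by move=> y /is_derive_d2phi[].
by move=> y yna; rewrite derive1E; have [_ ->] := is_derive_d2phi yna; exact: d3phi_gt0.
Qed.

Lemma phi_cvgy : - nu < a -> phi y @[y --> a^'-] --> +oo.
Proof.
move=> nua; apply/cvgryPge => N; pose A := (a + nu) / 2.
have N0 := sqr_ge0 N; near=> y.
have yA : A <= y + nu.
  suff : A - nu < y by lra.
  by near: y; apply: nbhs_left_gt; rewrite /A; lra.
have ya : 0 < a - y by rewrite subr_gt0; near: y; exact: nbhs_left_lt.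
have yN : (N ^+ 2 + 1) * (a - y) < A.
  rewrite mulrC -ltr_pdivlMr; last by rewrite ltr_wpDl.
  by near: y; apply: nbhs_left_ltBl; rewrite divr_gt0 ?ltr_wpDl// /A; lra.
apply: le_trans (ler_norm N) _; rewrite -sqrtr_sqr ler_wsqrtr// ler_pdivlMr//.
nra.
Unshelve. all: by end_near. Qed.

End Weight.

Section Potential.
Context {R : realType}.
Variables nu a : R.
Implicit Types p q : R.

Local Notation phi := (phi nu a).
Local Notation dphi := (dphi nu a).
Local Notation d2phi := (d2phi nu a).
Local Notation d3phi := (d3phi nu a).
Local Notation inflection := ((a - 3 * nu) / 4).

Definition J : R -> R -> R := trigmean 0 0 phi.
Definition Jp : R -> R -> R := trigmean 1 0 dphi.
Definition Jq : R -> R -> R := trigmean 0 1 dphi.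
Definition Jpp : R -> R -> R := trigmean 2 0 d2phi.
Definition Jpq : R -> R -> R := trigmean 1 1 d2phi.
Definition Jppq : R -> R -> R := trigmean 2 1 d3phi.
Definition Jpqq : R -> R -> R := trigmean 1 2 d3phi.

Lemma J_gradient p q : - nu < p < a -> - nu < q < a ->
  is_gradient J p q (Jp p q) (Jq p q).
Proof.
by apply: trigmean_is_gradient; [exact: is_derive_phi|exact: continuous_dphi].
Qed.

Lemma Jp_gradient p q : - nu < p < a -> - nu < q < a ->
  is_gradient Jp p q (Jpp p q) (Jpq p q).
Proof.
by apply: trigmean_is_gradient; [exact: is_derive_dphi|exact: continuous_d2phi].
Qed.

Lemma Jpq_gradient p q : - nu < p < a -> - nu < q < a ->
  is_gradient Jpq p q (Jppq p q) (Jpqq p q).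
Proof.
by apply: trigmean_is_gradient; [exact: is_derive_d2phi|exact: continuous_d3phi].
Qed.

Lemma trigseg_itvoo p q x : - nu < p < a -> - nu < q < a -> - nu < trigseg p q x < a.
Proof. by move=> pa qa; have := @trigseg_itv R `]- nu, a[ p q x pa qa; rewrite in_itv. Qed.

Lemma J_gt0 p q : - nu < p < a -> - nu < q < a -> 0 < J p q.
Proof.
move=> pa qa; apply: (@trigmean_gt0 _ (- nu) a) => // [|x _]; first exact: continuous_phi.
exact/phi_gt0/trigseg_itvoo.
Qed.

Lemma Jp_gt0 p q : - nu < p < a -> - nu < q < a -> 0 < Jp p q.
Proof.
move=> pa qa; apply: (@trigmean_gt0 _ (- nu) a) => // [|x _]; first exact: continuous_dphi.
exact/dphi_gt0/trigseg_itvoo.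
Qed.

Lemma Jppq_gt0 p q : - nu < p < a -> - nu < q < a -> 0 < Jppq p q.
Proof.
move=> pa qa; apply: (@trigmean_gt0 _ (- nu) a) => // [|x _]; first exact: continuous_d3phi.
exact/d3phi_gt0/trigseg_itvoo.
Qed.

Lemma Jpqq_gt0 p q : - nu < p < a -> - nu < q < a -> 0 < Jpqq p q.
Proof.
move=> pa qa; apply: (@trigmean_gt0 _ (- nu) a) => // [|x _]; first exact: continuous_d3phi.
exact/d3phi_gt0/trigseg_itvoo.
Qed.

Lemma Jp_sub_Jq p q : - nu < p < a -> - nu < q < a ->
  Jp p q - Jq p q = 2 * (p - q) * Jpq p q.
Proof.
move=> pa qa; rewrite -[Jp p q]mul1r -[Jq p q]mul1r.
exact: (trigmean_Euler_Poisson_Darboux (@is_derive_dphi _ nu a) (@continuous_d2phi _ nu a) 0 0).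
Qed.

Lemma Jpq_increasing q : - nu < q < a ->
  {in `]- nu, a[ &, {homo Jpq ^~ q : p p' / p < p'}}.
Proof.
move=> qa p p' pa pa'; apply: (@trigmean_increasing _ (- nu) a) => //.
  exact: continuous_d2phi.
exact: d2phi_increasing.
Qed.

Lemma Jpq_lt0 p q : - nu < p <= inflection -> - nu < q < inflection -> Jpq p q < 0.
Proof.
move=> pc qc; have pa : - nu < p < a by lra.
have qa : - nu < q < a by lra.
apply: (@trigmean_lt0 _ (- nu) a) => // [|x xpi]; first exact: continuous_d2phi.
by apply: d2phi_lt0; [exact: trigseg_itvoo|apply: trigseg_lt => //; lra].
Qed.

(* Chebyshev's argument: phi'' and sin^2 - s0 have the same sign along the segment. *)
Lemma Jpp_gt0 p q : - nu < q < inflection -> inflection < p < a -> 0 <= Jpq p q ->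
  0 < Jpp p q.
Proof.
move=> qc pc Jpq0; have pa : - nu < p < a by lra.
have qa : - nu < q < a by lra.
have pq : 0 < p - q by lra.
pose s0 := (inflection - q) / (p - q).
have s00 : 0 < s0 by rewrite divr_gt0//; lra.
have s01 : s0 < 1 by rewrite ltr_pdivrMr//; lra.
have segE x : trigseg p q x - inflection = (p - q) * (sin x ^+ 2 - s0).
  by rewrite trigsegE /s0; field; rewrite gt_eqF.
have JpDJq : Jpp p q + Jpq p q = trigmean 1 0 d2phi p q.
  by apply: (@trigmeanSD _ (- nu) a) => //; exact: continuous_d2phi.
have cint m n := trigmean_integrand_continuous (A := `[0, pi / 2]) (m := m) (n := n)
  (@continuous_d2phi _ nu a) pa qa.
suff : s0 * trigmean 1 0 d2phi p q < Jpp p q.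
  rewrite -JpDJq mulrDr; have := mulr_ge0 (ltW s00) Jpq0; move=> s0Jpq Jpps0.
  have : 0 < (1 - s0) * Jpp p q by lra.
  by rewrite pmulr_rgt0// subr_gt0.
rewrite -segment_RintegralZl//; apply: (@segment_lt_Rintegral _ _ _ _ _ (pi / 2)) => //.
- exact: pihalf_gt0.
- exact: within_continuousZl.
- move=> x _; have sna := trigseg_itvoo x pa qa; have /andP[w0 _] := trigweight_itv 1 0 x.
  rewrite (trigweightSl 1) mulrCA [leRHS]mulrCA [leLHS]mulrA [leRHS]mulrA ler_wpM2r//.
  rewrite mulrC -subr_ge0 -mulrBl -(pmulr_rge0 _ pq) mulrA -segE.
  have [yc|yc|->] := ltgtP (trigseg p q x) inflection; last by rewrite subrr mul0r.
    by rewrite mulr_le0//; [lra|exact/ltW/d2phi_lt0].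
  by rewrite mulr_ge0//; [lra|exact/ltW/d2phi_gt0].
- by rewrite lexx andbT ltW// pihalf_gt0.
rewrite /trigweight trigseg_pihalf sin_pihalf !expr1n expr0 !mulr1.
by rewrite gtr_pMl// d2phi_gt0//; lra.
Qed.

Lemma J_diag y : - nu < y < a -> J y y / Jp y y = 4 * (y + nu) * (a - y) / (a + nu).
Proof.
move=> ya; have JpqE := Jp_sub_Jq ya ya.
have JpDJq : Jp y y + Jq y y = dphi y * trigmean 0 0 (cst 1) y y.
  rewrite -trigmean_diag; apply: (trigmeanSD (lo := - nu) (hi := a)) => //.
  exact: continuous_dphi.
have := J_gt0 ya ya; have phi0 := phi_gt0 ya.
rewrite /J trigmean_diag pmulr_rgt0// => T0.
have [ynu ay] : y + nu != 0 /\ a - y != 0 by rewrite !gt_eqF//; lra.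
have -> : Jp y y = dphi y * trigmean 0 0 (cst 1) y y / 2 by lra.
rewrite /dphi; field; rewrite ynu ay !gt_eqF//; lra.
Qed.

(* Beyond a - d the segment is in its half nearer to p, where sin^2 x >= 1/2. *)
Lemma phi_trigseg_le p q d x : - nu < q -> q < p < a -> 0 < d <= (a - q) / 2 ->
  phi (trigseg p q x) <= 4 * d * (dphi (trigseg p q x) * sin x ^+ 2) + phi (a - d).
Proof.
move=> qnu pa da; have pna : - nu < p < a by lra.
have qna : - nu < q < a by lra.
have adna : - nu < a - d < a by lra.
have sna := trigseg_itvoo x pna qna; have /andP[ynu ya] := sna.
have phi0 := phi_gt0 sna; have dphi0 := dphi_gt0 sna; have phid0 := phi_gt0 adna.
have s2 := sqr_ge0 (sin x).
have [sd|dsy] := leP (trigseg p q x) (a - d).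
  have d40 : 0 <= 4 * d by lra.
  rewrite ler_wpDl ?(mulr_ge0 d40 (mulr_ge0 (ltW dphi0) s2))//.
  exact: (ltW_homo_in (@phi_increasing _ nu a)).
have sin_large : 1 / 2 <= sin x ^+ 2.
  have pq : 0 < p - q by lra.
  by rewrite -(ler_pM2l pq); move: dsy; rewrite trigsegE; lra.
have phi_small : phi (trigseg p q x) <= 2 * d * dphi (trigseg p q x).
  by apply: le_trans (phi_le_dphi sna) _; rewrite ler_pM2r//; lra.
have d20 : 0 < 2 * d by lra.
have := ler_pM (ltW phi0) (_ : 0 <= 1 / 2) phi_small sin_large.
rewrite divr_ge0// => /(_ isT); rewrite -mulrA. lra.
Qed.

Lemma J_le_Jp p q d : - nu < q -> q < p < a -> 0 < d <= (a - q) / 2 ->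
  J p q <= 4 * d * Jp p q + phi (a - d) * (pi / 2).
Proof.
move=> qnu pa da; have pna : - nu < p < a by lra.
have qna : - nu < q < a by lra.
apply: (@trigmean_le_affine _ (- nu) a) => //;
  [exact: continuous_phi|exact: continuous_dphi|move=> x _].
by rewrite trigweightSl /trigweight !expr0 !mulr1; exact: phi_trigseg_le.
Qed.

Lemma Jq_le_J p q : - nu < q -> q < p < a ->
  Jq p q <= (a + nu) / (2 * (q + nu) * (p - q)) * J p q.
Proof.
move=> qnu pa; have pna : - nu < p < a by lra.
have qna : - nu < q < a by lra.
rewrite -[leRHS]addr0 -[X in _ <= _ + X](mul0r (pi / 2)).
apply: (@trigmean_le_affine _ (- nu) a) => //;
  [exact: continuous_dphi|exact: continuous_phi|move=> x xpi].
rewrite trigweightSr /trigweight !expr0 !mulr1 addr0.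
have sna := trigseg_itvoo x pna qna; have /andP[ynu ya] := sna.
have phi0 := phi_gt0 sna.
have [c0 s0] := (sqr_ge0 (cos x), sqr_ge0 (sin x)).
have pq0 : 0 <= p - q by lra.
have qy : q + nu <= trigseg p q x + nu by rewrite trigsegE; have := mulr_ge0 pq0 s0; lra.
have cay : (p - q) * cos x ^+ 2 <= a - trigseg p q x by rewrite trigsegE sin2cos2; lra.
rewrite [leRHS]mulrAC -dphiE// ler_pdivlMr; last by rewrite !mulr_gt0//; lra.
have -> : dphi (trigseg p q x) * cos x ^+ 2 * (2 * (q + nu) * (p - q)) =
  2 * ((q + nu) * ((p - q) * cos x ^+ 2)) * dphi (trigseg p q x) by ring.
rewrite (ler_pM2r (dphi_gt0 sna)) ler_pM2l//.
by apply: ler_pM (mulr_ge0 pq0 c0) qy cay; lra.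
Qed.

Lemma phi_le_J p q : - nu < q -> q < p < a -> phi p <= J p q + 2 * (p - q) * Jp p q.
Proof.
move=> qnu pa; apply: (@trigmean_ge_endpoint _ (- nu) a).
- exact: is_derive_phi.
- exact: continuous_dphi.
- by move=> y /phi_gt0/ltW.
- by move=> y /dphi_gt0/ltW.
- by rewrite in_itv/=; lra.
- by rewrite in_itv/=; lra.
- lra.
Qed.

Lemma Jp_cvgy q : - nu < q < a -> Jp p q @[p --> a^'-] --> +oo.
Proof.
move=> qna; pose d := (a - q) / 2; pose C := phi (a - d) * (pi / 2).
have d0 : 0 < d by rewrite /d; lra.
have b0 : 0 < 4 * d + 2 * (a + nu) by lra.
apply/cvgryPge => N; near=> p.
have qp : q < p < a by apply/andP; split; near: p; [apply: nbhs_left_gt; lra|exact: nbhs_left_lt].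
have Jp0 : 0 < Jp p q by apply: Jp_gt0; lra.
have phip : C + (4 * d + 2 * (a + nu)) * N <= phi p.
  by near: p; move/cvgryPge: (@phi_cvgy _ nu a ltac:(lra)); exact.
rewrite -(ler_pM2l b0).
have JC : J p q <= 4 * d * Jp p q + C by apply: J_le_Jp; rewrite -/d; lra.
have phiJ : phi p <= J p q + 2 * (p - q) * Jp p q by apply: phi_le_J; lra.
have : 2 * (p - q) * Jp p q <= 2 * (a + nu) * Jp p q by rewrite ler_pM2r//; lra.
lra.
Unshelve. all: by end_near. Qed.

Lemma J_over_Jp_cvg0 q : - nu < q < a -> J p q / Jp p q @[p --> a^'-] --> 0.
Proof.
move=> qna; apply/cvgrPdist_le => e e0.
pose d := Num.min ((a - q) / 2) (e / 8); pose C := phi (a - d) * (pi / 2).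
have d0 : 0 < d by rewrite lt_min; lra.
have [da de] : d <= (a - q) / 2 /\ d <= e / 8 by rewrite !ge_min !lexx orbT.
near=> p.
have qp : q < p < a by apply/andP; split; near: p; [apply: nbhs_left_gt; lra|exact: nbhs_left_lt].
have Jp_large : 2 * C / e <= Jp p q by near: p; move/cvgryPge: (Jp_cvgy qna); exact.
have [J0 Jp0] : 0 < J p q /\ 0 < Jp p q by split; [apply: J_gt0|apply: Jp_gt0]; lra.
rewrite sub0r normrN gtr0_norm ?divr_gt0// ler_pdivrMr//.
have JC : J p q <= 4 * d * Jp p q + C by apply: J_le_Jp; lra.
have : 4 * d * Jp p q <= e / 2 * Jp p q by rewrite ler_pM2r//; lra.
by move: Jp_large; rewrite ler_pdivrMr//; lra.
Unshelve. all: by end_near. Qed.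

Lemma near_Jpq_gt0 q : - nu < q < a -> \forall p \near a^'-, 0 < Jpq p q.
Proof.
move=> qna; pose c := (a + nu) / ((q + nu) * (a - q)).
have c0 : 0 < c by rewrite divr_gt0 ?mulr_gt0//; lra.
near=> p.
have qp : (a + q) / 2 < p < a.
  by apply/andP; split; near: p; [apply: nbhs_left_gt; lra|exact: nbhs_left_lt].
have [pna q_lt_p] : - nu < p < a /\ 0 < 2 * (p - q) by split; lra.
have [J0 Jp0] := (J_gt0 pna qna, Jp_gt0 pna qna).
have JJp : J p q / Jp p q < c^-1.
  by near: p; apply: (cvgr_lt _ (J_over_Jp_cvg0 qna)); rewrite invr_gt0.
rewrite -(pmulr_rgt0 _ q_lt_p) -Jp_sub_Jq// subr_gt0.
apply: (@le_lt_trans _ _ (c * J p q)); last first.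
  by rewrite mulrC -ltr_pdivlMr// mulrC -ltr_pdivrMr// mulrC.
apply: le_trans (Jq_le_J _ _) _; [lra|lra|].
have [qnu anu] : 0 < q + nu /\ 0 < a + nu by split; lra.
rewrite ler_pM2r// ler_pM2l// lef_pV2 ?posrE ?mulr_gt0//; try lra.
by rewrite [leRHS]mulrAC [leLHS]mulrC ler_pM2r//; lra.
Unshelve. all: by end_near. Qed.

End Potential.

Section PhaseSpeeds.
Context {R : realType}.
Variables nu a : R.
Implicit Types p q x : R.

Local Notation J := (J nu a).
Local Notation Jp := (Jp nu a).
Local Notation Jq := (Jq nu a).
Local Notation Jpp := (Jpp nu a).
Local Notation Jpq := (Jpq nu a).
Local Notation Jppq := (Jppq nu a).
Local Notation Jpqq := (Jpqq nu a).
Local Notation inflection := ((a - 3 * nu) / 4).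

Definition speed2 p q : R := a + p + q + 2 * nu - J p q / Jp p q.
Definition speed3 p q : R := a + p + q + 2 * nu - J p q / Jq p q.

Lemma speed2_eq_speed3 p q : - nu < q -> q < p < a ->
  speed2 p q = speed3 p q <-> Jpq p q = 0.
Proof.
move=> qnu pa; have pna : - nu < p < a by lra.
have qna : - nu < q < a by lra.
have pq : 2 * (p - q) != 0 by rewrite gt_eqF//; lra.
have JpqE := Jp_sub_Jq pna qna; split=> [/addrI/oppr_inj|Jpq0]; last first.
  by congr (_ - _ / _); apply/eqP; rewrite -subr_eq0 JpqE Jpq0 mulr0.
move/(mulfI (lt0r_neq0 (J_gt0 pna qna)))/invr_inj => JpE.
by apply/eqP; rewrite -(mulIr_eq0 _ (mulIf pq)) mulrC -JpqE JpE subrr.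
Qed.

Lemma speed2_lt p q : - nu < p < a -> - nu < q < a -> speed2 p q < 2 * a + q + 2 * nu.
Proof.
move=> pna qna; have := divr_gt0 (J_gt0 pna qna) (Jp_gt0 pna qna).
by rewrite /speed2; lra.
Qed.

Lemma speed2_cvg (T : Type) (F : set_system T) {FF : Filter F} (u v : T -> R) p q :
  - nu < p < a -> - nu < q < a -> u x @[x --> F] --> p -> v x @[x --> F] --> q ->
  speed2 (u x) (v x) @[x --> F] --> speed2 p q.
Proof.
move=> pna qna up vq; apply: cvgB.
  by apply: cvgD; [apply: cvgD => //; apply: cvgD => //; exact: cvg_cst|exact: cvg_cst].
apply: cvgM; first exact: is_gradient_cvg (J_gradient pna qna) up vq.
apply: cvgV; first by rewrite gt_eqF// Jp_gt0.
exact: is_gradient_cvg (Jp_gradient pna qna) up vq.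
Qed.

Lemma speed2_is_derive (u v : R -> R) x du dv :
  - nu < u x < a -> - nu < v x < a -> is_derive x 1 u du -> is_derive x 1 v dv ->
  is_derive x 1 (fun s => speed2 (u s) (v s))
    (J (u x) (v x) * Jpp (u x) (v x) / Jp (u x) (v x) ^+ 2 * du +
     (1 - Jq (u x) (v x) / Jp (u x) (v x) +
      J (u x) (v x) * Jpq (u x) (v x) / Jp (u x) (v x) ^+ 2) * dv).
Proof.
move=> una vna u_du v_dv.
have Jp0 : Jp (u x) (v x) != 0 by rewrite gt_eqF// Jp_gt0.
have dJ := is_gradient_is_derive (J_gradient una vna) u_du v_dv.
have dJp := is_gradient_is_derive (Jp_gradient una vna) u_du v_dv.
by rewrite /speed2; apply: is_derive_eq; rewrite /GRing.scale/=; field.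
Qed.

Lemma speed2_cvg_leading q : - nu < q < a ->
  speed2 p q @[p --> a^'-] --> 2 * a + q + 2 * nu.
Proof.
move=> qna; rewrite [X in _ --> X](_ : _ = a + a + q + 2 * nu - 0); last by ring.
apply: cvgB (J_over_Jp_cvg0 qna).
apply: cvgD; last exact: cvg_cst.
apply: cvgD; last exact: cvg_cst.
by apply: cvgD; [exact: cvg_cst|apply: cvg_at_left_filter; exact: cvg_id].
Qed.

Lemma speed2_inflection : - nu < a -> speed2 inflection inflection = (3 * a - nu) / 4.
Proof.
by move=> nua; rewrite /speed2 J_diag; [field; rewrite gt_eqF//; lra|lra].
Qed.

Lemma continuous_Jpq q : - nu < q < a -> {in `]- nu, a[, continuous (Jpq ^~ q)}.
Proof.
by move=> qna p pna; exact: is_gradient_cvg (Jpq_gradient pna qna) cvg_id (cvg_cst _).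
Qed.

Lemma Jpq_root_exists q : - nu < q < inflection ->
  exists p, inflection < p < a /\ Jpq p q = 0.
Proof.
move=> qc; have qna : - nu < q < a by lra.
have Jpqc : Jpq inflection q < 0 by apply: Jpq_lt0; lra.
have [||||p /andP[cp pa] Jpq0] := @IVT_near_left _ (Jpq ^~ q) inflection a 0.
- by lra.
- apply: continuous_in_subspaceT => p; rewrite inE/= in_itv/= => pc.
  by apply: continuous_Jpq => //; rewrite in_itv/=; lra.
- exact: ltW.
- exact: near_Jpq_gt0.
exists p; split=> //; rewrite pa andbT lt_neqAle cp andbT.
by apply: contraTneq Jpqc => ->; rewrite Jpq0 ltxx.
Qed.

Definition Jpq_root q : R := get [set p | inflection < p < a /\ Jpq p q = 0].

Lemma Jpq_rootP q : - nu < q < inflection ->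
  inflection < Jpq_root q < a /\ Jpq (Jpq_root q) q = 0.
Proof. by move=> /Jpq_root_exists/getPex. Qed.

Lemma Jpq_root_itv q : - nu < q < inflection -> - nu < Jpq_root q < a.
Proof. by move=> /[dup] qc /Jpq_rootP[]; lra. Qed.

Lemma Jpq_lt_mono q : - nu < q < a -> {in `]- nu, a[ &, {mono Jpq ^~ q : p p' / p < p'}}.
Proof. by move=> qna; apply/leW_mono_in/le_mono_in/Jpq_increasing. Qed.

Lemma Jpq_sg_root p q : - nu < q < inflection -> - nu < p < a ->
  ((Jpq p q < 0) = (p < Jpq_root q)) * ((0 < Jpq p q) = (Jpq_root q < p)).
Proof.
move=> qc pna; have [_ Jpq0] := Jpq_rootP qc; have rna := Jpq_root_itv qc.
have qna : - nu < q < a by lra.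
by split; rewrite -{1}Jpq0 (Jpq_lt_mono qna).
Qed.

Lemma Jpq_root_unique p q : - nu < q < inflection -> - nu < p < a -> Jpq p q = 0 ->
  p = Jpq_root q.
Proof.
move=> qc pna Jpq0; have := Jpq_sg_root qc pna; rewrite Jpq0 ltxx => -[rp pr].
by case: ltgtP rp pr.
Qed.

Lemma Jpq_root_cvg (F : set_system R) {FF : Filter F} p q : - nu < p < a -> - nu < q < a ->
  F --> q -> (\forall x \near F, - nu < x < inflection) -> Jpq p q = 0 ->
  Jpq_root x @[x --> F] --> p.
Proof.
move=> pna qna Fq Fc Jpq0; apply/cvgrPdist_le => e e0.
pose d := Num.min e (Num.min ((a - p) / 2) ((p + nu) / 2)).
have d0 : 0 < d by rewrite !lt_min; lra.
have [de dap dpnu] : [/\ d <= e, d <= (a - p) / 2 & d <= (p + nu) / 2].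
  by rewrite !ge_min !lexx !orbT.
have [pdna pDna] : - nu < p - d < a /\ - nu < p + d < a by split; lra.
have Jpq_cvg r : - nu < r < a -> Jpq r x @[x --> F] --> Jpq r q.
  by move=> rna; exact: is_gradient_cvg (Jpq_gradient rna qna) (cvg_cst _) Fq.
have JpdN : Jpq (p - d) q < 0 by rewrite -Jpq0 (Jpq_lt_mono qna)//; lra.
have JpD0 : 0 < Jpq (p + d) q by rewrite -Jpq0 (Jpq_lt_mono qna)//; lra.
near=> x; have xc : - nu < x < inflection by near: x.
have : Jpq (p - d) x < 0 by near: x; exact: (cvgr_lt _ (Jpq_cvg _ pdna)).
have : 0 < Jpq (p + d) x by near: x; exact: (cvgr_gt _ (Jpq_cvg _ pDna)).
rewrite !Jpq_sg_root// ler_norml; lra.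
Unshelve. all: by end_near. Qed.

Lemma continuous_Jpq_root : {in `]- nu, inflection[, continuous Jpq_root}.
Proof.
move=> q qI; have qc : - nu < q < inflection by move: qI; rewrite in_itv.
apply: (Jpq_root_cvg (Jpq_root_itv qc) (q := q)) => //; first lra.
  exact: near_in_itvoo qI.
by have [] := Jpq_rootP qc.
Qed.

Lemma Jpq_inflection : Jpq inflection inflection = 0.
Proof.
rewrite /Jpq trigmean_diag (_ : d2phi nu a inflection = 0) ?mul0r// /d2phi.
by rewrite (_ : 4 * _ + _ - _ = 0) ?(mulr0, mul0r)//; lra.
Qed.

Lemma Jpq_root_cvg_inflection : - nu < a -> Jpq_root q @[q --> inflection^'-] --> inflection.
Proof.
move=> nua; apply: (@Jpq_root_cvg _ _ _ inflection);
  [lra|lra|exact: cvg_at_left_filter| |exact: Jpq_inflection].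
near=> x; apply/andP; split; near: x; first by apply: nbhs_left_gt; lra.
exact: nbhs_left_lt.
Unshelve. all: by end_near. Qed.

Definition dJpq_root q : R := - Jpqq (Jpq_root q) q / Jppq (Jpq_root q) q.

Lemma Jpq_root_is_derive q : - nu < q < inflection -> is_derive q 1 Jpq_root (dJpq_root q).
Proof.
move=> qc; have [rc Jpq0] := Jpq_rootP qc; have rna := Jpq_root_itv qc.
have qna : - nu < q < a by lra.
have qI : q \in `]- nu, inflection[ by rewrite in_itv.
apply: (is_derive_implicit (F := Jpq) (Jpq_gradient rna qna)).
- by rewrite gt_eqF// Jppq_gt0.
- exact: continuous_Jpq_root.
- by apply: filterS (near_in_itvoo qI) => s /Jpq_rootP[_ ->].
Qed.

Lemma dJpq_root_lt0 q : - nu < q < inflection -> dJpq_root q < 0.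
Proof.
move=> qc; have rna := Jpq_root_itv qc; have qna : - nu < q < a by lra.
by rewrite /dJpq_root mulNr oppr_lt0 divr_gt0 ?Jpqq_gt0 ?Jppq_gt0.
Qed.

Definition dspeed2 p q : R := J p q * Jpp p q / Jp p q ^+ 2.

Lemma dspeed2_gt0 p q : - nu < q < inflection -> Jpq_root q <= p < a -> 0 < dspeed2 p q.
Proof.
move=> qc rp; have [rc Jpq0] := Jpq_rootP qc.
have [pna qna] : - nu < p < a /\ - nu < q < a by split; lra.
have Jpp0 : 0 < Jpp p q.
  by apply: Jpp_gt0 => //; [lra|rewrite leNgt Jpq_sg_root// -leNgt; lra].
exact: divr_gt0 (mulr_gt0 (J_gt0 pna qna) Jpp0) (exprn_gt0 2 (Jp_gt0 pna qna)).
Qed.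

Lemma speed2_is_derive_l p q : - nu < p < a -> - nu < q < a ->
  is_derive p 1 (speed2 ^~ q) (dspeed2 p q).
Proof.
move=> pna qna.
have := @speed2_is_derive id (cst q) p 1 0 pna qna (is_derive_id p 1) (is_derive_cst q p 1).
by rewrite mulr0 addr0 mulr1.
Qed.

Definition common_speed q : R := speed2 (Jpq_root q) q.

Definition dcommon_speed q : R := dspeed2 (Jpq_root q) q * dJpq_root q.

(* On the curve Jpq = 0 one has Jp = Jq, so the partial derivative of speed2 in q vanishes. *)
Lemma common_speed_is_derive q : - nu < q < inflection ->
  is_derive q 1 common_speed (dcommon_speed q).
Proof.
move=> qc; have [rc Jpq0] := Jpq_rootP qc; have rna := Jpq_root_itv qc.
have qna : - nu < q < a by lra.
have JqE : Jq (Jpq_root q) q = Jp (Jpq_root q) q.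
  by apply/esym/eqP; rewrite -subr_eq0 Jp_sub_Jq// Jpq0 mulr0.
have := speed2_is_derive rna qna (Jpq_root_is_derive qc) (is_derive_id q 1).
by rewrite JqE Jpq0 divff ?gt_eqF ?Jp_gt0// subrr mulr0 mul0r addr0 mul0r addr0.
Qed.

Lemma continuous_common_speed : {in `]- nu, inflection[, continuous common_speed}.
Proof.
by move=> q; rewrite in_itv/= => /common_speed_is_derive; exact: is_derive_continuous.
Qed.

Lemma dcommon_speed_lt0 q : - nu < q < inflection -> dcommon_speed q < 0.
Proof.
move=> qc; have [rc _] := Jpq_rootP qc.
by rewrite /dcommon_speed pmulr_rlt0 ?dJpq_root_lt0// dspeed2_gt0//; lra.
Qed.

Lemma common_speed_decreasing :
  {in `]- nu, inflection[ &, {mono common_speed : q q' /~ q < q'}}.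
Proof.
apply/leW_nmono_in/le_nmono_in/ltr0_derive1_lt_oo.
- by move=> q; rewrite in_itv/= => /common_speed_is_derive[].
- move=> q; rewrite in_itv/= => qc; rewrite derive1E.
  have [_ ->] := common_speed_is_derive qc; exact: dcommon_speed_lt0.
- by move=> q; rewrite inE; exact: continuous_common_speed.
Qed.

Lemma common_speed_cvg_trailing : - nu < a ->
  common_speed q @[q --> inflection^'-] --> (3 * a - nu) / 4.
Proof.
move=> nua; rewrite -speed2_inflection//.
by apply: speed2_cvg; [lra|lra|exact: Jpq_root_cvg_inflection|exact: cvg_at_left_filter].
Qed.

Lemma common_speed_gt q : - nu < q < inflection -> (3 * a - nu) / 4 < common_speed q.
Proof.
move=> qc; pose m := (q + inflection) / 2.
have mc : - nu < m < inflection by rewrite /m; lra.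
apply: (@le_lt_trans _ _ (common_speed m)); last first.
  by rewrite common_speed_decreasing ?in_itv//= /m; lra.
apply: cvgr_to_le (common_speed_cvg_trailing _) _; first lra.
near=> y; have my : m < y by near: y; apply: nbhs_left_gt; lra.
have yc : y < inflection by near: y; exact: nbhs_left_lt.
by rewrite ltW// common_speed_decreasing// in_itv//=; lra.
Unshelve. all: by end_near. Qed.

Lemma common_speed_onto q xi : - nu < q < inflection ->
  (3 * a - nu) / 4 < xi <= common_speed q ->
  exists2 y, q <= y < inflection & common_speed y = xi.
Proof.
move=> qc xic.
have [||||y yc /oppr_inj yxi] :=
  @IVT_near_left _ (fun y => - common_speed y) q inflection (- xi).
- by lra.
- apply: continuous_in_subspaceT => y; rewrite inE/= in_itv/= => yc.
  by apply/continuousN/continuous_common_speed; rewrite in_itv/=; lra.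
- by rewrite lerN2; lra.
- have nua : - nu < a by lra.
  near=> y; rewrite ltrN2; near: y.
  by apply: (cvgr_lt _ (common_speed_cvg_trailing nua)); lra.
by exists y.
Unshelve. all: by end_near. Qed.

Lemma speed2_continuous q : - nu < q < a -> {in `]- nu, a[, continuous (speed2 ^~ q)}.
Proof.
move=> qna p; rewrite in_itv/= => pna.
exact: speed2_cvg pna qna cvg_id (cvg_cst _).
Qed.

Lemma within_speed2_continuous q : - nu < q < inflection ->
  {within `[Jpq_root q, a[, continuous (speed2 ^~ q)}.
Proof.
move=> qc; have rna := Jpq_root_itv qc.
apply: continuous_in_subspaceT => p; rewrite inE/= in_itv/= => rpa.
by apply: speed2_continuous; rewrite ?in_itv/=; lra.
Qed.

Lemma speed2_increasing q : - nu < q < inflection ->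
  {in `[Jpq_root q, a[ &, {mono speed2 ^~ q : p p' / p < p'}}.
Proof.
move=> qc; have rna := Jpq_root_itv qc; have qna : - nu < q < a by lra.
have speed2_drv p : p \in `]Jpq_root q, a[ ->
    is_derive p 1 (speed2 ^~ q) (dspeed2 p q).
  by rewrite in_itv/= => rp; apply: speed2_is_derive_l => //; lra.
apply/leW_mono_in/le_mono_in/gtr0_derive1_lt_co; last exact: within_speed2_continuous.
- by move=> p /speed2_drv[].
- move=> p rp; rewrite derive1E; have [_ ->] := speed2_drv _ rp.
  by apply: dspeed2_gt0 => //; move: rp; rewrite in_itv/=; lra.
Qed.

Lemma speed2_onto q xi : - nu < q < inflection ->
  common_speed q <= xi < 2 * a + q + 2 * nu ->
  exists2 p, Jpq_root q <= p < a & speed2 p q = xi.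
Proof.
move=> qc xic; have rna := Jpq_root_itv qc; have qna : - nu < q < a by lra.
apply: IVT_near_left.
- lra.
- exact: within_speed2_continuous.
- by case/andP: xic.
by apply: (cvgr_gt _ (speed2_cvg_leading qna)); lra.
Qed.

End PhaseSpeeds.

Section WhithamIntegral.
Context {R : realType}.
Variables nu a : R.
Implicit Types p q x y : R.
Notation mu := (@lebesgue_measure R).

Definition whitham_integrand p q y : R :=
  (y + nu) / Num.sqrt ((y + nu) * (a - y) * (p - y) * (y - q)).

Lemma continuous_whitham_integrand p q : - nu < q -> p < a ->
  {in `]q, p[, continuous (whitham_integrand p q)}.
Proof.
move=> qnu pa y; rewrite in_itv/= => yqp.
have radicand0 : 0 < (y + nu) * (a - y) * (p - y) * (y - q) by rewrite !mulr_gt0//; lra.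
apply: cvgM; first by apply: cvgD; [exact: cvg_id|exact: cvg_cst].
apply: cvgV; first by rewrite gt_eqF// sqrtr_gt0.
apply: (@continuous_comp _ _ _
  (fun z : R => (z + nu) * (a - z) * (p - z) * (z - q)) Num.sqrt); last exact: sqrt_continuous.
by apply/differentiable_continuous/derivable1_diffP; exact: ex_derive.
Qed.

(* The substitution y = p sin^2 x + q cos^2 x turns (p - y) (y - q) into a perfect square. *)
Lemma whitham_integrand_trigseg p q x : - nu < q -> q < p < a -> 0 < x < pi / 2 ->
  whitham_integrand p q (trigseg p q x) * (2 * (p - q) * (sin x * cos x)) =
  2 * phi nu a (trigseg p q x).
Proof.
move=> qnu qpa xpi; have [pna qna] : - nu < p < a /\ - nu < q < a by split; lra.
have yna := trigseg_itvoo x pna qna; have [s0 c0] := sin_cos_pihalf_gt0 xpi.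
have pyE : p - trigseg p q x = (p - q) * cos x ^+ 2 by rewrite trigsegE cos2sin2; ring.
have yqE : trigseg p q x - q = (p - q) * sin x ^+ 2 by rewrite trigsegE; ring.
have phi0 := phi_gt0 yna; rewrite /whitham_integrand pyE yqE.
move: (trigseg p q x) => y in yna phi0 *.
have ynuE : y + nu = phi nu a y ^+ 2 * (a - y).
  by rewrite sqr_phi// divfK// gt_eqF//; lra.
pose root := phi nu a y * (a - y) * ((p - q) * (sin x * cos x)).
have root0 : 0 < root by rewrite !mulr_gt0//; lra.
have -> : (y + nu) * (a - y) * ((p - q) * cos x ^+ 2) * ((p - q) * sin x ^+ 2) = root ^+ 2.
  by rewrite ynuE /root; ring.
rewrite sqrtr_sqr gtr0_norm// ynuE /root; field.
by rewrite !gt_eqF//; lra.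
Qed.

Lemma Iint_J p q : - nu < q -> q < p < a -> Iint nu a p q = 2 * J nu a p q.
Proof.
move=> qnu qpa; have [pna qna] : - nu < p < a /\ - nu < q < a by split; lra.
have qp : q < p by case/andP: qpa.
have cint : {within `[0, pi / 2], continuous (fun x =>
    phi nu a (trigseg p q x) * trigweight 0 0 x)}.
  exact: trigmean_integrand_continuous (@continuous_phi _ nu a) pna qna.
rewrite /J /trigmean -segment_RintegralZl// segment_Rintegral_itvoo; last first.
  exact: within_continuousZl.
have -> : Iint nu a p q =
    \int[mu]_(y in `]trigseg p q 0, trigseg p q (pi / 2)[) whitham_integrand p q y.
  by rewrite trigseg0 trigseg_pihalf.
rewrite (@ge0_integration_by_substitution_itvoo _ _ (fun x => 2 * (p - q) * (sin x * cos x))).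
- apply: eq_Rintegral => x; rewrite inE/= in_itv/= => xpi.
  by rewrite whitham_integrand_trigseg// /trigweight !expr0 !mulr1.
- exact: pihalf_gt0.
- exact/continuous_subspaceT/continuous_trigseg.
- by move=> x _; exact: is_derive_trigseg.
- move=> x _; apply: cvgM; first exact: cvg_cst.
  by apply: cvgM; [exact: continuous_sin|exact: continuous_cos].
- move=> x; rewrite in_itv/= => /sin_cos_pihalf_gt0[s0 c0]; rewrite !mulr_gt0//; lra.
- by rewrite trigseg0 trigseg_pihalf; apply: continuous_whitham_integrand; lra.
- rewrite trigseg0 trigseg_pihalf => y; rewrite in_itv/= => yqp.
  by rewrite divr_ge0 ?sqrtr_ge0//; lra.
Qed.

Lemma dI2_Jp p q : - nu < q -> q < p < a -> dI2 nu a p q = 2 * Jp nu a p q.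
Proof.
move=> qnu qpa; have [pna qna] : - nu < p < a /\ - nu < q < a by split; lra.
have dJ := is_gradient_is_derive (J_gradient pna qna) (is_derive_id p 1) (is_derive_cst q p 1).
have d2J : is_derive p 1 (fun s => 2 * J nu a s q) (2 * Jp nu a p q).
  by apply: is_derive_eq; rewrite /GRing.scale/=; ring.
rewrite /dI2 derive1E; case: d2J => _ <-; apply: near_eq_derive.
by near=> s; rewrite Iint_J//; near: s; apply: (@near_in_itvoo _ q a); rewrite in_itv.
Unshelve. all: by end_near. Qed.

Lemma dI3_Jq p q : - nu < q -> q < p < a -> dI3 nu a p q = 2 * Jq nu a p q.
Proof.
move=> qnu qpa; have [pna qna] : - nu < p < a /\ - nu < q < a by split; lra.
have dJ := is_gradient_is_derive (J_gradient pna qna) (is_derive_cst p q 1) (is_derive_id q 1).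
have d2J : is_derive q 1 (fun s => 2 * J nu a p s) (2 * Jq nu a p q).
  by apply: is_derive_eq; rewrite /GRing.scale/=; ring.
rewrite /dI3 derive1E; case: d2J => _ <-; apply: near_eq_derive.
have qI : q \in `]- nu, p[ by rewrite in_itv/=; lra.
apply: filterS (near_in_itvoo qI) => s; rewrite in_itv/= => sp.
by rewrite Iint_J//; lra.
Qed.

Lemma lam2_speed2 p q : - nu < q -> q < p < a -> lam2 nu a p q = speed2 nu a p q.
Proof. by move=> qnu qpa; rewrite /lam2 Iint_J// dI2_Jp// -mulf_div divff// mul1r. Qed.

Lemma lam3_speed3 p q : - nu < q -> q < p < a -> lam3 nu a p q = speed3 nu a p q.
Proof. by move=> qnu qpa; rewrite /lam3 Iint_J// dI3_Jq// -mulf_div divff// mul1r. Qed.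

End WhithamIntegral.

Section SelfSimilarProfiles.
Context {R : realType}.
Variables nu a b : R.
Implicit Types xi q p : R.

Local Notation inflection := ((a - 3 * nu) / 4).
Local Notation trailing := ((3 * a - nu) / 4).
Local Notation leading := (2 * a + b + 2 * nu).
Local Notation speed2 := (speed2 nu a).
Local Notation speed3 := (speed3 nu a).
Local Notation root := (Jpq_root nu a).
Local Notation common_speed := (common_speed nu a).

Hypothesis bc : - nu < b < inflection.

Definition common_speed_inv : R -> R := 'pinv_(cst b) `]- nu, inflection[ common_speed.

Definition speed2_inv : R -> R := 'pinv_(cst b) `]root b, a[ (speed2 ^~ b).

Lemma swept_itv q : b <= q < inflection -> - nu < q < inflection.
Proof. by have := bc; lra. Qed.

Lemma root_itv : inflection < root b < a.
Proof. by have [] := Jpq_rootP bc. Qed.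

Lemma common_speed_inj : {in `]- nu, inflection[ &, injective common_speed}.
Proof.
move=> q y qc yc qy; have dec := @common_speed_decreasing _ nu a.
by have := dec _ _ qc yc; have := dec _ _ yc qc; rewrite qy ltxx; case: ltgtP.
Qed.

Lemma speed2_inj : {in `]root b, a[ &, injective (speed2 ^~ b)}.
Proof.
move=> p y pc yc py; have inc := speed2_increasing bc.
have sub z : z \in `]root b, a[ -> z \in `[root b, a[ by rewrite !in_itv/= => /andP[/ltW-> ->].
have := inc _ _ (sub _ pc) (sub _ yc); have := inc _ _ (sub _ yc) (sub _ pc).
by rewrite py ltxx; case: ltgtP.
Qed.

Lemma common_speedK : {in `]- nu, inflection[, cancel common_speed common_speed_inv}.
Proof.
by move=> q qc; apply: pinvKV; rewrite ?inE// => y z; rewrite !inE; exact: common_speed_inj.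
Qed.

Lemma speed2K : {in `]root b, a[, cancel (speed2 ^~ b) speed2_inv}.
Proof.
by move=> p pc; apply: pinvKV; rewrite ?inE// => y z; rewrite !inE; exact: speed2_inj.
Qed.

Definition profile3 xi : R := if xi <= common_speed b then common_speed_inv xi else b.

Definition profile2 xi : R :=
  if xi <= common_speed b then root (common_speed_inv xi) else speed2_inv xi.

Lemma profile_common_speed q : b <= q < inflection ->
  profile3 (common_speed q) = q /\ profile2 (common_speed q) = root q.
Proof.
move=> bq; have qc := swept_itv bq.
have cq : common_speed q <= common_speed b.
  by rewrite leNgt common_speed_decreasing ?in_itv//= -leNgt; lra.
by rewrite /profile3 /profile2 cq common_speedK// in_itv.
Qed.

Lemma profile_speed2 p : root b < p < a ->
  profile3 (speed2 p b) = b /\ profile2 (speed2 p b) = p.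
Proof.
move=> rp; have ra := root_itv.
have cp : common_speed b < speed2 p b.
  by rewrite (speed2_increasing bc) ?in_itv//=; lra.
by rewrite /profile3 /profile2 leNgt cp/= speed2K// in_itv.
Qed.

Lemma speed2_onto_itvoo xi : common_speed b < xi < leading ->
  exists2 p, root b < p < a & speed2 p b = xi.
Proof.
move=> xic; have [|p /andP[rp pa] pxi] := @speed2_onto _ nu a b xi bc; first lra.
exists p => //; rewrite pa andbT lt_neqAle rp andbT; apply: contraTneq xic => rE.
by rewrite -pxi -rE ltxx.
Qed.

Lemma profile_itv xi : trailing < xi < leading ->
  b <= profile3 xi /\ profile3 xi < profile2 xi < a.
Proof.
move=> xiW; have [xil|xir] := leP xi (common_speed b).
  have [|q qc <-] := @common_speed_onto _ nu a b xi bc; first lra.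
  by have [-> ->] := profile_common_speed qc; have [rc _] := Jpq_rootP (swept_itv qc); lra.
have [|p pc <-] := @speed2_onto_itvoo xi; first lra.
by have [-> ->] := profile_speed2 pc; have := root_itv; have := bc; lra.
Qed.

Lemma profile_speed_left xi : trailing < xi <= common_speed b ->
  speed2 (profile2 xi) (profile3 xi) = xi /\ speed3 (profile2 xi) (profile3 xi) = xi.
Proof.
move=> /(common_speed_onto bc)[q bq <-]; have [-> ->] := profile_common_speed bq.
have qc := swept_itv bq; have [rc Jpq0] := Jpq_rootP qc; split=> //.
by rewrite -(proj2 (speed2_eq_speed3 _ _)) //; lra.
Qed.

Lemma profile_speed_right xi : common_speed b <= xi < leading ->
  speed2 (profile2 xi) b = xi /\ profile3 xi = b.
Proof.
rewrite le_eqVlt => /andP[/orP[/eqP <- _|bxi xil]].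
  by have [|-> ->] := @profile_common_speed b; [have := bc; lra|].
have [|p pc <-] := @speed2_onto_itvoo xi; first by rewrite bxi.
by have [-> ->] := profile_speed2 pc.
Qed.

Lemma common_speed_inv_is_derive q : - nu < q < inflection ->
  exists l, is_derive (common_speed q) 1 common_speed_inv l.
Proof.
move=> qc; eexists; apply: is_derive_pinv (common_speed_is_derive qc) _.
- exact: continuous_common_speed.
- exact: common_speed_inj.
- by rewrite in_itv.
- by rewrite lt_eqF// dcommon_speed_lt0.
Qed.

Lemma speed2_inv_is_derive p : root b < p < a ->
  exists l, is_derive (speed2 p b) 1 speed2_inv l.
Proof.
move=> rp; have [rc bna] := (root_itv, bc).
have [pna qna] : - nu < p < a /\ - nu < b < a by split; lra.
eexists; apply: is_derive_pinv (speed2_is_derive_l pna qna) _.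
- by move=> y; rewrite in_itv/= => yr; apply: speed2_continuous; rewrite ?in_itv/=; lra.
- exact: speed2_inj.
- by rewrite in_itv.
- by rewrite gt_eqF// dspeed2_gt0//; lra.
Qed.

Lemma profile_derivable_left xi : trailing < xi < common_speed b ->
  derivable profile2 xi 1 /\ derivable profile3 xi 1.
Proof.
move=> xic; have [|q bq qxi] := @common_speed_onto _ nu a b xi bc; first lra.
have qc := swept_itv bq; have [l dinv] := common_speed_inv_is_derive qc.
have invq : common_speed_inv (common_speed q) = q by rewrite common_speedK ?in_itv.
have near_left : \forall y \near common_speed q, y <= common_speed b.
  have qb : common_speed q < common_speed b by rewrite qxi; case/andP: xic.
  by apply: filterS (lt_nbhsl qb) => y /ltW.
rewrite -qxi; split.
  apply: (near_eq_derivable (f := root \o common_speed_inv)).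
    by near=> y; rewrite /profile2 ifT//; near: y.
  have droot := Jpq_root_is_derive qc; rewrite -{1}invq in droot.
  by have [] := is_derive1_comp droot dinv.
apply: (near_eq_derivable (f := common_speed_inv)); last by case: dinv.
by near=> y; rewrite /profile3 ifT//; near: y.
Unshelve. all: by end_near. Qed.

Lemma profile_is_derive_right xi : common_speed b < xi < leading ->
  derivable profile2 xi 1 /\ is_derive xi 1 profile3 0.
Proof.
move=> /[dup] /andP[bxi _] /speed2_onto_itvoo[p rp pxi]; have [l dinv] := speed2_inv_is_derive rp.
have near_right : \forall y \near xi, y <= common_speed b = false.
  by apply: filterS (lt_nbhsr bxi) => y by_; apply/negbTE; rewrite -ltNge.
split.
  apply: (near_eq_derivable (f := speed2_inv)); last by rewrite -pxi; case: dinv.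
  by near=> y; rewrite /profile2 ifF//; near: y.
apply: near_eq_is_derive (is_derive_cst b xi 1).
by near=> y; rewrite /profile3 ifF//; near: y.
Unshelve. all: by end_near. Qed.

Lemma near_trailing_profile q : b <= q < inflection ->
  \forall xi \near trailing^'+,
    q <= profile3 xi < inflection /\ profile2 xi = root (profile3 xi).
Proof.
move=> bq; have qc := swept_itv bq; near=> xi.
have [|y yq <-] := @common_speed_onto _ nu a q xi qc.
  apply/andP; split; first by near: xi; exact: nbhs_right_gt.
  by apply: ltW; near: xi; apply: nbhs_right_lt; exact: common_speed_gt.
by have [|-> ->] := @profile_common_speed y; [lra|].
Unshelve. all: by end_near. Qed.

Lemma profile3_cvg_trailing : profile3 xi @[xi --> trailing^'+] --> inflection.
Proof.
have b0 := bc; apply/cvgrPdist_le => e e0; pose q := Num.max b (inflection - e).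
have [bq eq] : b <= q /\ inflection - e <= q by split; rewrite le_max lexx ?orbT.
have qc : q < inflection by rewrite gt_max; lra.
have := @near_trailing_profile q; rewrite bq qc => /(_ isT).
by apply: filterS => xi [pc _]; rewrite ler_norml; lra.
Qed.

Lemma profile2_cvg_trailing : profile2 xi @[xi --> trailing^'+] --> inflection.
Proof.
have b0 := bc; have near_trailing := @near_trailing_profile b ltac:(lra).
have : root (profile3 xi) @[xi --> trailing^'+] --> inflection.
  apply: (Jpq_root_cvg (F := profile3 @ trailing^'+)) profile3_cvg_trailing _ _; [lra|lra| |].
    by apply: filterS near_trailing => xi [/swept_itv].
  exact: Jpq_inflection.
apply: cvg_trans; apply: near_eq_cvg.
by apply: filterS near_trailing => xi [_ ->].
Qed.

Lemma near_leading_profile p : root b < p < a ->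
  \forall xi \near leading^'-, p <= profile2 xi < a /\ profile3 xi = b.
Proof.
move=> rp; have [rc b0] := (root_itv, bc).
have bp : common_speed b < speed2 p b by rewrite (speed2_increasing bc) ?in_itv//=; lra.
have pl : speed2 p b < leading by apply: speed2_lt; lra.
near=> xi; have pxi : speed2 p b < xi by near: xi; exact: nbhs_left_gt.
have [|y yc yxi] := @speed2_onto_itvoo xi.
  by apply/andP; split; [exact: lt_trans pxi|near: xi; exact: nbhs_left_lt].
have py : p < y by rewrite -(speed2_increasing bc) ?yxi ?in_itv//=; lra.
by rewrite -yxi; have [-> ->] := profile_speed2 yc; split=> //; lra.
Unshelve. all: by end_near. Qed.

Lemma profile2_cvg_leading : profile2 xi @[xi --> leading^'-] --> a.
Proof.
have rc := root_itv; apply/cvgrPdist_le => e e0.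
pose p := (a + Num.max (root b) (a - e)) / 2.
have [rm em] : root b <= Num.max (root b) (a - e) /\ a - e <= Num.max (root b) (a - e).
  by split; rewrite le_max lexx ?orbT.
have ma : Num.max (root b) (a - e) < a by rewrite gt_max; lra.
have rp : root b < p < a by rewrite /p; lra.
have := near_leading_profile rp.
by apply: filterS => xi [pa _]; move: pa; rewrite ler_norml /p; lra.
Qed.

Lemma profile3_cvg_leading : profile3 xi @[xi --> leading^'-] --> b.
Proof.
have rc := root_itv; apply: cvg_near_cst.
apply: filterS (@near_leading_profile ((root b + a) / 2) _) => [xi []//|].
by lra.
Qed.

Lemma oppr_nu_lt : - nu < b.
Proof. by case/andP: bc. Qed.

Lemma b_lt_root_lt : b < root b < a.
Proof. by have := root_itv; have := bc; lra. Qed.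

Lemma lam2_root : lam2 nu a (root b) b = common_speed b.
Proof. exact: lam2_speed2 oppr_nu_lt b_lt_root_lt. Qed.

Lemma lam2_eq_lam3_root : lam2 nu a (root b) b = lam3 nu a (root b) b.
Proof.
rewrite lam2_speed2 ?lam3_speed3 ?oppr_nu_lt ?b_lt_root_lt//.
by apply/(speed2_eq_speed3 oppr_nu_lt b_lt_root_lt); have [] := Jpq_rootP bc.
Qed.

Lemma lam2_eq_lam3_unique v : b < v < a -> lam2 nu a v b = lam3 nu a v b -> v = root b.
Proof.
move=> vb; rewrite lam2_speed2 ?lam3_speed3 ?oppr_nu_lt// => /(speed2_eq_speed3 oppr_nu_lt vb).
by apply: Jpq_root_unique => //; have := oppr_nu_lt; lra.
Qed.

Lemma common_speed_itv : trailing < common_speed b < leading.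
Proof.
rewrite common_speed_gt// speed2_lt//; last by have := b_lt_root_lt; have := oppr_nu_lt; lra.
by have := b_lt_root_lt; have := oppr_nu_lt; lra.
Qed.

Lemma profile_lamE xi : trailing < xi < leading ->
  lam2 nu a (profile2 xi) (profile3 xi) = speed2 (profile2 xi) (profile3 xi) /\
  lam3 nu a (profile2 xi) (profile3 xi) = speed3 (profile2 xi) (profile3 xi).
Proof.
move=> xiW; have [bu3 u32] := profile_itv xiW.
have u3nu : - nu < profile3 xi := lt_le_trans oppr_nu_lt bu3.
by rewrite lam2_speed2 ?lam3_speed3.
Qed.

Lemma profile_lam_left xi : trailing < xi <= common_speed b ->
  lam2 nu a (profile2 xi) (profile3 xi) = xi /\ lam3 nu a (profile2 xi) (profile3 xi) = xi.
Proof.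
move=> xil; have [s2 s3] := profile_speed_left xil.
by have [|-> ->] := @profile_lamE xi; first (have := common_speed_itv; lra).
Qed.

Lemma profile_lam_right xi : common_speed b <= xi < leading ->
  lam2 nu a (profile2 xi) b = xi /\ profile3 xi = b.
Proof.
move=> xir; have [s2 u3b] := profile_speed_right xir; split=> //.
have [|] := @profile_lamE xi; first (have := common_speed_itv; lra).
by rewrite u3b s2.
Qed.

Lemma profile2_transport x t : 0 < t -> trailing < x / t < leading -> x / t != common_speed b ->
  transport_at (fun x t => profile2 (x / t))
    (fun x t => lam2 nu a (profile2 (x / t)) (profile3 (x / t))) x t.
Proof.
move=> t0 xiW; rewrite neq_lt => /orP[xil|xir].
  have [|/derivableP profile2_deriv _] := @profile_derivable_left (x / t); first lra.
  apply: (transport_selfsimilar t0 _ profile2_deriv) => //; right.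
  by apply: (proj1 (profile_lam_left _)); lra.
have [|/derivableP profile2_deriv _] := @profile_is_derive_right (x / t); first lra.
apply: (transport_selfsimilar t0 _ profile2_deriv) => //; right.
by have [|lam2xi ->] := @profile_lam_right (x / t); first lra.
Qed.

Lemma profile3_transport x t : 0 < t -> trailing < x / t < leading -> x / t != common_speed b ->
  transport_at (fun x t => profile3 (x / t))
    (fun x t => lam3 nu a (profile2 (x / t)) (profile3 (x / t))) x t.
Proof.
move=> t0 xiW; rewrite neq_lt => /orP[xil|xir].
  have [|_ /derivableP profile3_deriv] := @profile_derivable_left (x / t); first lra.
  apply: (transport_selfsimilar t0 _ profile3_deriv) => //; right.
  by apply: (proj2 (profile_lam_left _)); lra.
have [|_ profile3_deriv] := @profile_is_derive_right (x / t); first lra.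
by apply: (transport_selfsimilar t0 _ profile3_deriv) => //; left.
Qed.

Lemma profile_implicit_left x t : 0 < t -> trailing < x / t <= common_speed b ->
  x = lam2 nu a (profile2 (x / t)) (profile3 (x / t)) * t /\
  x = lam3 nu a (profile2 (x / t)) (profile3 (x / t)) * t.
Proof. by move=> t0 /profile_lam_left[-> ->]; rewrite divfK// gt_eqF. Qed.

Lemma profile_implicit_right x t : 0 < t -> common_speed b <= x / t < leading ->
  x = lam2 nu a (profile2 (x / t)) b * t /\ profile3 (x / t) = b.
Proof. by move=> t0 /profile_lam_right[-> ->]; rewrite divfK// gt_eqF. Qed.

Lemma profile_trailing_edge t : 0 < t ->
  profile2 (x / t) @[x --> (t * trailing)^'+] --> inflection /\
  profile3 (x / t) @[x --> (t * trailing)^'+] --> inflection.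
Proof.
move=> t0; have ratio := @ratio_cvg_at_right R t trailing t0.
by split; apply: cvg_comp ratio _; [exact: profile2_cvg_trailing|exact: profile3_cvg_trailing].
Qed.

Lemma profile_leading_edge t : 0 < t ->
  profile2 (x / t) @[x --> (t * leading)^'-] --> a /\
  profile3 (x / t) @[x --> (t * leading)^'-] --> b.
Proof.
move=> t0; have ratio := @ratio_cvg_at_left R t leading t0.
by split; apply: cvg_comp ratio _; [exact: profile2_cvg_leading|exact: profile3_cvg_leading].
Qed.

Lemma trailing_lt_leading : trailing < leading.
Proof. by case/andP: common_speed_itv; exact: lt_trans. Qed.

Lemma burgers_outer_le x t : 0 < t -> x / t <= trailing -> burgers_outer nu a b x t = a.
Proof. by move=> t0 xk; rewrite burgers_outerE// xk. Qed.

Lemma burgers_outer_ge x t : 0 < t -> leading <= x / t -> burgers_outer nu a b x t = b.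
Proof.
by move=> t0 kx; rewrite burgers_outerE// leNgt (lt_le_trans trailing_lt_leading kx).
Qed.

Lemma burgers_outer_trailing t : 0 < t -> burgers_outer nu a b (t * trailing) t = a.
Proof. by move=> t0; rewrite burgers_outer_le// mulrAC divff ?gt_eqF// mul1r. Qed.

Lemma burgers_outer_leading t : 0 < t -> burgers_outer nu a b (t * leading) t = b.
Proof. by move=> t0; rewrite burgers_outer_ge// mulrAC divff ?gt_eqF// mul1r. Qed.

End SelfSimilarProfiles.

Theorem theorem4p1 (R : realType) (nu a b : R) :
  0 < b + nu < (a + nu) / 4 ->
  exists us : R,
    (* (1) unique solution u* of lambda_2(a,u,b) = lambda_3(a,u,b) in ]b,a[ *)
    [/\ b < us < a, lam2 nu a us b = lam3 nu a us b &
        forall v : R, b < v < a -> lam2 nu a v b = lam3 nu a v b -> v = us] /\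
    let alpha := lam2 nu a us b in
    (* (2) the Whitham zone *)
    exists u2 u3 : R -> R -> R,
      let u1 := fun (_ _ : R) => a in
      let inW := fun x t : R => 0 < t /\ (3 * a - nu) / 4 < x / t < 2 * a + b + 2 * nu in
      [/\ (forall x t, inW x t -> b <= u3 x t /\ u3 x t < u2 x t < a),
          (forall x t, inW x t -> x / t <= alpha ->
             x = lam2 nu a (u2 x t) (u3 x t) * t /\
             x = lam3 nu a (u2 x t) (u3 x t) * t),
          (forall x t, inW x t -> alpha <= x / t ->
             x = lam2 nu a (u2 x t) b * t /\ u3 x t = b),
          (* Whitham equations (classically, off the weak-discontinuity line x/t = alpha) *)
          (forall x t, inW x t -> x / t != alpha ->
             [/\ transport_at u1 (fun x t => lam1 nu (u1 x t) (u2 x t) (u3 x t)) x t,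
                 transport_at u2 (fun x t => lam2 nu (u1 x t) (u2 x t) (u3 x t)) x t &
                 transport_at u3 (fun x t => lam3 nu (u1 x t) (u2 x t) (u3 x t)) x t]) &
          (* (3) Burgers region and matching at the edges *)
          [/\ (forall x, x < 0 -> burgers_outer nu a b x 0 = a) /\
                (forall x, 0 < x -> burgers_outer nu a b x 0 = b),
              (forall x t, 0 < t -> x / t <= (3 * a - nu) / 4 -> burgers_outer nu a b x t = a) /\
                (forall x t, 0 < t -> 2 * a + b + 2 * nu <= x / t -> burgers_outer nu a b x t = b),
              (forall x t, 0 < t ->
                 (x / t < (3 * a - nu) / 4 \/ 2 * a + b + 2 * nu < x / t) ->
                 transport_at (burgers_outer nu a b)
                   (fun x t => 3 * burgers_outer nu a b x t + 2 * nu) x t),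
              (* trailing edge: u1 = u and u2 = u3 *)
              (forall t, 0 < t ->
                 u1 (t * ((3 * a - nu) / 4)) t = burgers_outer nu a b (t * ((3 * a - nu) / 4)) t /\
                 exists c : R,
                   u2 x t @[x --> (t * ((3 * a - nu) / 4))^'+] --> c /\
                   u3 x t @[x --> (t * ((3 * a - nu) / 4))^'+] --> c) &
              (* leading edge: u1 = u2 and u3 = u *)
              (forall t, 0 < t ->
                 u2 x t @[x --> (t * (2 * a + b + 2 * nu))^'-] --> u1 (t * (2 * a + b + 2 * nu)) t /\
                 u3 x t @[x --> (t * (2 * a + b + 2 * nu))^'-] -->
                   burgers_outer nu a b (t * (2 * a + b + 2 * nu)) t)]].
Proof.
move=> bA; have bc : - nu < b < (a - 3 * nu) / 4 by lra.
exists (Jpq_root nu a b); split.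
  by split; [exact: b_lt_root_lt|exact: lam2_eq_lam3_root|exact: lam2_eq_lam3_unique].
rewrite /= lam2_root//.
exists (fun x t => profile2 nu a b (x / t)), (fun x t => profile3 nu a b (x / t)); split.
- by move=> x t [_ /profile_itv]; exact.
- by move=> x t [t0 /andP[xi_gt _]] xi_le; apply: profile_implicit_left => //; rewrite xi_gt.
- by move=> x t [t0 /andP[_ xi_lt]] xi_ge; apply: profile_implicit_right => //; rewrite xi_ge.
- move=> x t [t0 xiW] xi_neq; split; first exact: transport_cst.
    exact: profile2_transport.
  exact: profile3_transport.
split.
- by split=> x; have [] := burgers_outer_initial nu a b x.
- by split=> x t; [exact: burgers_outer_le|exact: burgers_outer_ge].
- move=> x t t0 xi_out; apply: burgers_outer_transport => //.
  by have := trailing_lt_leading bc; rewrite neq_lt; lra.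
- move=> t t0; rewrite burgers_outer_trailing//; split=> //.
  by exists ((a - 3 * nu) / 4); exact: profile_trailing_edge.
- by move=> t t0; rewrite burgers_outer_leading//; exact: profile_leading_edge.
Qed.
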